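(* Let $f:[0,1]\to\mathbb C$ with $\|f\|_\infty<\infty$, $f\in\mathcal L^1_1([0,1])$, and $\widehat T_1^k(\mathbb 1_{Y_k}f)\in\mathrm{BV}(Y)$ for all $k\in\mathbb N_0$. If $$\sum_{k=0}^{\infty}\big\|\widehat T_1^k(\mathbb 1_{Y_k}f)\big\|_\infty<\infty,$$ then for every $x\in Y$, $\lim_{n\to\infty}\ln(n)\cdot\widehat T_1^n(f)(x)=\int f\,\mathrm{d}\mu_1$.
   Context: $T_1$ is the Farey map: $T_1(x)=\frac x{1-x}$ ($x\le1/2$), $\frac{1-x}x$ ($x>1/2$), inverse branches $f_{1,0}(x)=\frac x{1+x}$, $f_{1,1}(x)=\frac1{1+x}$. $\mu_1$ has density $h_1(x)=1/x$; $\mathcal L^1_1([0,1])$ is the space of $\mu_1$-integrable functions. $\mathcal P_1 f=|f_{1,0}'|\,f\circ f_{1,0}+|f_{1,1}'|\,f\circ f_{1,1}$ and $\widehat T_1(f)=\mathcal P_1(fh_1)/h_1$. $Y=[1/2,1]$, $Y_0=Y$ and $Y_k=T_1^{-k}(Y)\setminus\bigcup_{j<k}T_1^{-j}(Y)=[1/(k+2),1/(k+1))$ for $k\ge1$. $\mathrm{BV}(Y)$ is the space of right-continuous $g:[0,1]\to\mathbb C$ supported in $Y$ of bounded variation; $\|\cdot\|_\infty$ is the sup norm. *)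

(* Defs.v *)
From Stdlib Require Import Reals Lra Lia.
Open Scope R_scope.

Fixpoint Rsum (u : nat -> R) (n : nat) : R :=
  match n with O => 0 | S m => Rsum u m + u m end.

Definition Cpx : Type := (R * R)%type.
Definition C0 : Cpx := (0, 0).
Definition Cadd (z w : Cpx) : Cpx := (fst z + fst w, snd z + snd w).
Definition Csub (z w : Cpx) : Cpx := (fst z - fst w, snd z - snd w).
Definition Cscal (r : R) (z : Cpx) : Cpx := (r * fst z, r * snd z).
Definition Cnorm (z : Cpx) : R := sqrt (fst z ^ 2 + snd z ^ 2).

(* inverse branches and (formulas for) their derivatives *)
Definition f10 (x : R) : R := x / (1 + x).
Definition f11 (x : R) : R := 1 / (1 + x).
Definition df10 (x : R) : R := / ((1 + x) ^ 2).
Definition df11 (x : R) : R := - / ((1 + x) ^ 2).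
(* density of mu_1 (note: in Stdlib, / 0 = 0) *)
Definition h1 (x : R) : R := / x.

Definition P1 (g : R -> Cpx) (x : R) : Cpx :=
  Cadd (Cscal (Rabs (df10 x)) (g (f10 x))) (Cscal (Rabs (df11 x)) (g (f11 x))).

Definition hatT1 (g : R -> Cpx) (x : R) : Cpx :=
  Cscal (/ h1 x) (P1 (fun y => Cscal (h1 y) (g y)) x).

Definition hatT1_iter (n : nat) (g : R -> Cpx) : R -> Cpx := Nat.iter n hatT1 g.

Definition inY (x : R) : Prop := / 2 <= x <= 1.

Definition inYk (k : nat) (x : R) : Prop :=
  match k with
  | O => / 2 <= x <= 1
  | S _ => / INR (k + 2) <= x < / INR (k + 1)
  end.

Definition restrYk (k : nat) (g : R -> Cpx) (x : R) : Cpx :=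
  match k with
  | O => if Rle_dec (/ 2) x then if Rle_dec x 1 then g x else C0 else C0
  | S _ => if Rle_dec (/ INR (k + 2)) x then
             if Rlt_dec x (/ INR (k + 1)) then g x else C0
           else C0
  end.

Definition right_continuous01 (g : R -> Cpx) : Prop :=
  forall x, 0 <= x < 1 -> forall eps, 0 < eps -> exists d, 0 < d /\
    forall y, x <= y < x + d -> y <= 1 -> Cnorm (Csub (g y) (g x)) < eps.

Definition supported_in_Y (g : R -> Cpx) : Prop :=
  forall x, 0 <= x <= 1 -> ~ inY x -> g x = C0.

Definition bounded_variation01 (g : R -> Cpx) : Prop :=
  exists V, forall (n : nat) (p : nat -> R),
    p O = 0 -> p n = 1 -> (forall i, (i < n)%nat -> p i <= p (S i)) ->
    Rsum (fun i => Cnorm (Csub (g (p (S i))) (g (p i)))) n <= V.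

Definition BV_Y (g : R -> Cpx) : Prop :=
  right_continuous01 g /\ supported_in_Y g /\ bounded_variation01 g.

Definition sup_norm_is (g : R -> Cpx) (s : R) : Prop :=
  is_lub (fun r => exists x, 0 <= x <= 1 /\ r = Cnorm (g x)) s.

Definition bounded01 (g : R -> Cpx) : Prop :=
  exists M, forall x, 0 <= x <= 1 -> Cnorm (g x) <= M.

Definition HK_integral (g : R -> R) (a b I : R) : Prop :=
  forall eps, 0 < eps -> exists delta : R -> R, (forall t, 0 < delta t) /\
    forall (n : nat) (p t : nat -> R),
      p O = a -> p n = b ->
      (forall i, (i < n)%nat ->
         p i <= t i <= p (S i) /\
         t i - delta (t i) < p i /\ p (S i) < t i + delta (t i)) ->
      Rabs (Rsum (fun i => g (t i) * (p (S i) - p i)) n - I) < eps.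

Definition HK_integrable (g : R -> R) (a b : R) : Prop :=
  exists I, HK_integral g a b I.

(* Lebesgue integrability on [a,b]: g and |g| HK-integrable *)
Definition L1_integrable (g : R -> R) (a b : R) : Prop :=
  HK_integrable g a b /\ HK_integrable (fun x => Rabs (g x)) a b.

(* real / imaginary part of f * h_1 on [0,1] (value at 0 irrelevant) *)
Definition re_dens (f : R -> Cpx) (x : R) : R := fst (f x) * h1 x.
Definition im_dens (f : R -> Cpx) (x : R) : R := snd (f x) * h1 x.

Definition mu1_integrable (f : R -> Cpx) : Prop :=
  L1_integrable (re_dens f) 0 1 /\ L1_integrable (im_dens f) 0 1.

Definition mu1_integral_is (f : R -> Cpx) (I : Cpx) : Prop :=
  HK_integral (re_dens f) 0 1 (fst I) /\ HK_integral (im_dens f) 0 1 (snd I).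

(* Main.v *)
(* On (0,1] the operator acts as [L u x = (u (x/(1+x)) + x u (1/(1+x))) / (1+x)], applied to
   the real and imaginary parts.  [L] preserves the cone of increasing concave functions on
   [0,1]; as [L u 1 = u (1/2)], for [u] in the cone [c_n = L^n u 1] is nonincreasing and
   [c_{n+1} <= L^n u <= c_n] on [Y].  Unfolding the returns to [Y] turns the conservation law
   [integral (L^n u) dmu = integral u dmu = m] into
   [c_n ln (1 + n) <= m <= c_n ln (1 + j) + (n + 1) / (1 + j)] for every [j], so that
   [ln n * L^n u -> m] on [Y].

   The functions [min(x,c)] lie in the cone and their linear combinations squeeze the
   indicators of intervals, hence, by positivity, Riemann sums for [f] on [[eta,1]], where [f]
   has bounded variation; Cousin's lemma makes these sums fine for the gauge of the
   Henstock-Kurzweil integral.  The part of [f] on [(0,eta)] is controlled by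
   [|L^k (1_{Y_k} f)| <= s_k 1_Y] with [s_k] summable, the bound [L^n 1_Y = O(1/ln n)] on [Y]
   and the boundedness of [f], which gives [s_k = O(1/k)]. *)
From Stdlib Require Import Reals Lra Lia Compare_dec Classical_Prop.
From Coquelicot Require Import Coquelicot.
Require Import Defs.
Open Scope R_scope.

(** * The normalised transfer operator and its invariant cone *)

Definition Lop (u : R -> R) (x : R) : R :=
  (u (x / (1 + x)) + x * u (1 / (1 + x))) / (1 + x).

Definition Lit (n : nat) (u : R -> R) : R -> R := Nat.iter n Lop u.

Lemma Lit_S n u x : Lit (S n) u x = Lop (Lit n u) x.
Proof. reflexivity. Qed.

Lemma Lit_add_iter n k u : Lit (n + k) u = Lit n (Lit k u).
Proof. unfold Lit; induction n as [|n IH]; simpl; congruence. Qed.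

Lemma f10_bounds_pos x : 0 < x <= 1 -> 0 < x / (1 + x) <= 1.
Proof.
  intros Hx; split.
  - apply Rdiv_lt_0_compat; lra.
  - apply Rle_div_l; lra.
Qed.

Lemma f11_bounds x : 0 <= x <= 1 -> / 2 <= 1 / (1 + x) <= 1.
Proof.
  intros Hx; split.
  - apply Rle_div_r; lra.
  - apply Rle_div_l; lra.
Qed.

Lemma f10_iter n x : 0 < x -> 0 <= n ->
  (x / (1 + x)) / (1 + n * (x / (1 + x))) = x / (1 + (n + 1) * x).
Proof.
  intros Hx Hn; field; repeat split; nra.
Qed.

Lemma Lit_le n u v x : 0 < x <= 1 ->
  (forall y, x / (1 + INR n * x) <= y <= 1 -> u y <= v y) ->
  Lit n u x <= Lit n v x.
Proof.
  revert x; induction n as [|n IH]; intros x Hx Huv.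
  - apply Huv; simpl; split; [|lra].
    apply Req_le; field.
  - rewrite !Lit_S; unfold Lop.
    pose proof (pos_INR n) as Hn. rewrite S_INR in Huv.
    assert (H1 : Lit n u (x / (1 + x)) <= Lit n v (x / (1 + x))).
    { apply IH; [now apply f10_bounds_pos|].
      intros y Hy; apply Huv. rewrite f10_iter in Hy; lra. }
    assert (H2 : Lit n u (1 / (1 + x)) <= Lit n v (1 / (1 + x))).
    { pose proof (f11_bounds x ltac:(lra)).
      apply IH; [lra|].
      intros y Hy; apply Huv; split; [|lra].
      apply Rle_trans with (2 := proj1 Hy).
      replace (1 / (1 + x) / (1 + INR n * (1 / (1 + x)))) with (/ (1 + x + INR n))
        by (field; lra).
      apply Rle_div_l; [nra|].
      rewrite Rmult_comm; apply Rle_div_r; nra. }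
    apply Rmult_le_compat_r; [left; apply Rinv_0_lt_compat; lra|].
    nra.
Qed.

Lemma Lit_le01 n u v x : 0 < x <= 1 ->
  (forall y, 0 < y <= 1 -> u y <= v y) -> Lit n u x <= Lit n v x.
Proof.
  intros Hx H; apply Lit_le; [easy|].
  intros y Hy; apply H; split; [|lra].
  apply Rlt_le_trans with (2 := proj1 Hy).
  pose proof (pos_INR n); apply Rdiv_lt_0_compat; nra.
Qed.

Lemma Lit_ext n u v x : 0 < x <= 1 ->
  (forall y, 0 < y <= 1 -> u y = v y) -> Lit n u x = Lit n v x.
Proof.
  intros Hx H; apply Rle_antisym; apply Lit_le01; try easy;
    intros y Hy; rewrite (H y Hy); lra.
Qed.

Lemma Lit_plus n u v x :
  Lit n (fun y => u y + v y) x = Lit n u x + Lit n v x.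
Proof.
  revert x; induction n as [|n IH]; intros x; [easy|].
  rewrite !Lit_S; unfold Lop; rewrite !IH; unfold Rdiv; ring.
Qed.

Lemma Lit_scal n a u x : Lit n (fun y => a * u y) x = a * Lit n u x.
Proof.
  revert x; induction n as [|n IH]; intros x; [easy|].
  rewrite !Lit_S; unfold Lop; rewrite !IH; unfold Rdiv; ring.
Qed.

Lemma Lit_minus n u v x :
  Lit n (fun y => u y - v y) x = Lit n u x - Lit n v x.
Proof.
  revert x; induction n as [|n IH]; intros x; [easy|].
  rewrite !Lit_S; unfold Lop; rewrite !IH; unfold Rdiv; ring.
Qed.

Lemma Lit_0 n x : Lit n (fun _ => 0) x = 0.
Proof.
  revert x; induction n as [|n IH]; intros x; [easy|].
  rewrite !Lit_S; unfold Lop; rewrite !IH; unfold Rdiv; ring.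
Qed.

Lemma Lit_Rsum n (u : nat -> R -> R) K x :
  Lit n (fun y => Rsum (fun k => u k y) K) x = Rsum (fun k => Lit n (u k) x) K.
Proof.
  induction K as [|K IH]; simpl; [apply Lit_0|].
  now rewrite Lit_plus, IH.
Qed.

Lemma Lit_abs_le n u v x : 0 < x <= 1 ->
  (forall y, x / (1 + INR n * x) <= y <= 1 -> Rabs (u y) <= v y) ->
  Rabs (Lit n u x) <= Lit n v x.
Proof.
  intros Hx H; apply Rabs_le; split.
  - replace (- Lit n v x) with (Lit n (fun y => (-1) * v y) x) by (rewrite Lit_scal; ring).
    apply Lit_le; [easy|]. intros y Hy; pose proof (Rabs_le_between' (u y) 0 (v y)) as E.
    replace (u y - 0) with (u y) in E by ring. destruct (proj1 E (H y Hy)); lra.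
  - apply Lit_le; [easy|]. intros y Hy; apply Rle_trans with (2 := H y Hy), Rle_abs.
Qed.

Lemma Lit_ge0 n u x : 0 < x <= 1 ->
  (forall y, 0 < y <= 1 -> 0 <= u y) -> 0 <= Lit n u x.
Proof.
  intros Hx H; rewrite <- (Lit_0 n x); now apply Lit_le01.
Qed.

Lemma Lit_1 n x : 0 < x <= 1 -> Lit n (fun _ => 1) x = 1.
Proof.
  revert x; induction n as [|n IH]; intros x Hx; [easy|].
  rewrite !Lit_S; unfold Lop; rewrite !IH; [field; lra| |now apply f10_bounds_pos].
  pose proof (f11_bounds x ltac:(lra)); lra.
Qed.

Definition incr_concave (u : R -> R) : Prop :=
  (forall x y, 0 <= x -> x <= y -> y <= 1 -> u x <= u y) /\
  (forall x y l, 0 <= x <= 1 -> 0 <= y <= 1 -> 0 <= l <= 1 ->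
     l * u x + (1 - l) * u y <= u (l * x + (1 - l) * y)).

Definition sym_avg (u : R -> R) (y : R) : R := y * u (1 - y) + (1 - y) * u y.

Lemma Lop_sym_avg u x : 0 <= x -> Lop u x = sym_avg u (1 / (1 + x)).
Proof.
  intros Hx; unfold Lop, sym_avg.
  replace (1 - 1 / (1 + x)) with (x / (1 + x)) by (field; lra).
  field; lra.
Qed.

(* The value [sym_avg u y] is the height at [2 y (1 - y)] of the chord of [u] over
   [[1 - y, y]]: growing [y] lowers the chord and moves the point to the left. *)
Lemma sym_avg_decr u y y' : incr_concave u ->
  / 2 <= y -> y <= y' -> y' <= 1 -> sym_avg u y' <= sym_avg u y.
Proof.
  intros [Hi Hc] Hy Hyy Hy'.
  destruct (Req_dec y y') as [->|Hne]; [lra|].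
  set (l := (y' - y) / (2 * y' - 1)).
  assert (Hl : 0 <= l <= 1).
  { unfold l; split; [apply Rle_div_r; lra|apply Rle_div_l; lra]. }
  assert (E : l * (2 * y' - 1) = y' - y) by (unfold l; field; lra).
  pose proof (Hc (1 - y') y' l ltac:(lra) ltac:(lra) Hl) as H1.
  pose proof (Hc y' (1 - y') l ltac:(lra) ltac:(lra) Hl) as H2.
  replace (l * (1 - y') + (1 - l) * y') with y in H1 by lra.
  replace (l * y' + (1 - l) * (1 - y')) with (1 - y) in H2 by lra.
  pose proof (Hi (1 - y') y' ltac:(lra) ltac:(lra) Hy') as H3.
  unfold sym_avg.
  set (a := u (1 - y')) in *; set (b := u y') in *.
  apply Rle_trans with (y * (l * b + (1 - l) * a) + (1 - y) * (l * a + (1 - l) * b)).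
  - assert (0 <= (b - a) * (y' - (y * (1 - l) + (1 - y) * l))).
    { apply Rmult_le_pos; nra. }
    nra.
  - apply Rplus_le_compat; apply Rmult_le_compat_l; lra.
Qed.

Lemma sym_avg_concave u y y' l : incr_concave u ->
  / 2 <= y <= 1 -> / 2 <= y' <= 1 -> 0 <= l <= 1 ->
  l * sym_avg u y + (1 - l) * sym_avg u y' <= sym_avg u (l * y + (1 - l) * y').
Proof.
  intros [Hi Hc] Hy Hy' Hl; unfold sym_avg.
  pose proof (Hc y y' l ltac:(lra) ltac:(lra) Hl) as H1.
  pose proof (Hc (1 - y) (1 - y') l ltac:(lra) ltac:(lra) Hl) as H2.
  replace (l * (1 - y) + (1 - l) * (1 - y')) with (1 - (l * y + (1 - l) * y')) in H2 by ring.
  assert (Hm1 : 0 <= (y - y') * (u y - u y')).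
  { destruct (Rle_dec y y').
    - pose proof (Hi y y' ltac:(lra) ltac:(lra) ltac:(lra)); nra.
    - pose proof (Hi y' y ltac:(lra) ltac:(lra) ltac:(lra)); nra. }
  assert (Hm2 : 0 <= (y - y') * (u (1 - y') - u (1 - y))).
  { destruct (Rle_dec y y').
    - pose proof (Hi (1 - y') (1 - y) ltac:(lra) ltac:(lra) ltac:(lra)); nra.
    - pose proof (Hi (1 - y) (1 - y') ltac:(lra) ltac:(lra) ltac:(lra)); nra. }
  set (z := l * y + (1 - l) * y') in *.
  assert (Hz : / 2 <= z <= 1) by (unfold z; nra).
  apply Rle_trans with (z * (l * u (1 - y) + (1 - l) * u (1 - y')) +
                        (1 - z) * (l * u y + (1 - l) * u y')).
  - assert (Hll : 0 <= l * (1 - l)) by nra.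
    pose proof (Rmult_le_pos _ _ Hll Hm1) as K1.
    pose proof (Rmult_le_pos _ _ Hll Hm2) as K2.
    unfold z; nra.
  - apply Rplus_le_compat; apply Rmult_le_compat_l; lra.
Qed.

Lemma inv1p_decr x y : 0 <= x -> x <= y -> 1 / (1 + y) <= 1 / (1 + x).
Proof.
  intros Hx Hy; unfold Rdiv; rewrite !Rmult_1_l; apply Rinv_le_contravar; lra.
Qed.

Lemma inv1p_convex x y l : 0 <= x -> 0 <= y -> 0 <= l <= 1 ->
  1 / (1 + (l * x + (1 - l) * y)) <= l * (1 / (1 + x)) + (1 - l) * (1 / (1 + y)).
Proof.
  intros Hx Hy Hl.
  assert (0 < 1 + (l * x + (1 - l) * y)) by nra.
  apply Rle_div_l; [lra|].
  replace ((l * (1 / (1 + x)) + (1 - l) * (1 / (1 + y))) * (1 + (l * x + (1 - l) * y)))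
    with (1 + l * (1 - l) * (x - y) ^ 2 / ((1 + x) * (1 + y))) by (field; lra).
  assert (0 <= l * (1 - l) * (x - y) ^ 2 / ((1 + x) * (1 + y))); [|lra].
  apply Rle_div_r; [nra|].
  rewrite Rmult_0_l; apply Rmult_le_pos; [nra|apply pow2_ge_0].
Qed.

Lemma Lop_incr_concave u : incr_concave u -> incr_concave (Lop u).
Proof.
  intros Hu; split.
  - intros x y Hx Hxy Hy.
    rewrite !Lop_sym_avg by lra.
    apply sym_avg_decr; [easy| | |].
    + apply (f11_bounds y); lra.
    + now apply inv1p_decr.
    + apply (f11_bounds x); lra.
  - intros x y l Hx Hy Hl.
    assert (0 <= l * x + (1 - l) * y <= 1) by nra.
    rewrite !Lop_sym_avg by lra.
    pose proof (f11_bounds x Hx) as Bx; pose proof (f11_bounds y Hy) as By.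
    eapply Rle_trans; [now apply sym_avg_concave|].
    apply sym_avg_decr; [easy| | |].
    + apply (f11_bounds (l * x + (1 - l) * y)); lra.
    + apply inv1p_convex; lra.
    + nra.
Qed.

Lemma Lit_incr_concave n u : incr_concave u -> incr_concave (Lit n u).
Proof.
  intros Hu; induction n as [|n IH]; [easy|]. now apply Lop_incr_concave.
Qed.

Lemma Lit_half n u : Lit n u (/ 2) = Lit (S n) u 1.
Proof.
  rewrite Lit_S; unfold Lop.
  replace (1 / (1 + 1)) with (/ 2) by field. field.
Qed.

Lemma Lit_incr_concave_Y n u x : incr_concave u -> / 2 <= x <= 1 ->
  Lit (S n) u 1 <= Lit n u x <= Lit n u 1.
Proof.
  intros Hu Hx; destruct (Lit_incr_concave n u Hu) as [Hi _].
  rewrite <- Lit_half; split; apply Hi; lra.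
Qed.

Lemma Lit_at1_decr n j u : incr_concave u -> Lit (n + j) u 1 <= Lit n u 1.
Proof.
  intros Hu; induction j as [|j IH]; [rewrite Nat.add_0_r; lra|].
  rewrite Nat.add_succ_r.
  pose proof (Lit_incr_concave_Y (n + j) u 1 Hu ltac:(lra)); lra.
Qed.

(** * Conservation of mass and the cone asymptotics *)

Definition Pden (w : R -> R) (x : R) : R :=
  (w (x / (1 + x)) + w (1 / (1 + x))) / (1 + x) ^ 2.

Definition Pit (n : nat) (w : R -> R) : R -> R := Nat.iter n Pden w.

Lemma Pit_S n w x : Pit (S n) w x = Pden (Pit n w) x.
Proof. reflexivity. Qed.

Lemma Lit_Pit n u w x : 0 <= x -> (forall y, 0 <= y -> u y = y * w y) ->
  Lit n u x = x * Pit n w x.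
Proof.
  intros Hx H; revert x Hx; induction n as [|n IH]; intros x Hx; [now apply H|].
  rewrite Lit_S, Pit_S; unfold Lop, Pden.
  rewrite !IH; [field; lra| |].
  - apply Rle_div_r; lra.
  - apply Rle_div_r; lra.
Qed.

Lemma continuous_inv1p a x : -1 < x -> continuous (fun y => a / (1 + y)) x.
Proof.
  intros Hx. apply (ex_derive_continuous (fun y => a / (1 + y))).
  auto_derive; lra.
Qed.

Lemma Pit_continuous n w : (forall x, continuous w x) ->
  forall x, - / INR (S n) < x -> continuous (Pit n w) x.
Proof.
  intros Hw; induction n as [|n IH]; intros x Hx; [apply Hw|].
  pose proof (pos_INR n) as Hn.
  assert (Hi : / INR (S n) <= 1).
  { rewrite <- Rinv_1; apply Rinv_le_contravar; rewrite ?S_INR; lra. }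
  assert (Hx1 : -1 < x * INR (S (S n))).
  { apply Rmult_lt_compat_r with (r := INR (S (S n))) in Hx; [|rewrite !S_INR; lra].
    rewrite Ropp_mult_distr_l_reverse, Rinv_l in Hx; [lra|rewrite !S_INR; lra]. }
  rewrite !S_INR in Hx1.
  assert (Hx2 : -1 < x) by nra.
  assert (Hi' : 0 < / INR (S n)) by (apply Rinv_0_lt_compat; rewrite S_INR; lra).
  apply (continuous_mult (fun x => Pit n w (x / (1 + x)) + Pit n w (1 / (1 + x)))
                         (fun x => / (1 + x) ^ 2)).
  - apply (continuous_plus (fun x => Pit n w (x / (1 + x))) (fun x => Pit n w (1 / (1 + x)))).
    + apply (continuous_comp (fun x => x / (1 + x)) (Pit n w)).
      * apply (ex_derive_continuous (fun y => y / (1 + y))). auto_derive; lra.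
      * apply IH. apply Rlt_div_r; [lra|].
        apply Rmult_lt_reg_r with (INR (S n)); [rewrite S_INR; lra|].
        replace (- / INR (S n) * (1 + x) * INR (S n)) with (- (1 + x))
          by (field; rewrite S_INR; lra).
        rewrite S_INR; lra.
    + apply (continuous_comp (fun x => 1 / (1 + x)) (Pit n w)).
      * now apply continuous_inv1p.
      * apply IH. apply Rlt_trans with 0; [lra|]. apply Rdiv_lt_0_compat; lra.
  - apply (ex_derive_continuous (fun y => / (1 + y) ^ 2)). auto_derive.
    nra.
Qed.

Lemma is_RInt_Pden w d : 0 < d -> (forall x, - d < x -> continuous w x) ->
  is_RInt (Pden w) 0 1 (RInt w 0 1).
Proof.
  intros Hd Hw.
  assert (Hex : forall a b, 0 <= a -> 0 <= b -> ex_RInt w a b).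
  { intros a b Ha Hb; apply (ex_RInt_continuous (V := R_CompleteNormedModule)).
    intros z [Hz _]; apply Hw. apply Rlt_le_trans with (2 := Hz).
    unfold Rmin; destruct (Rle_dec a b); lra. }
  assert (H1 : is_RInt (fun x => scal (/ (1 + x) ^ 2) (w (x / (1 + x)))) 0 1
                 (RInt w (0 / (1 + 0)) (1 / (1 + 1)))).
  { apply (is_RInt_comp w (fun x => x / (1 + x)) (fun x => / (1 + x) ^ 2)).
    - intros x; rewrite Rmin_left, Rmax_right by lra; intros Hx.
      apply Hw. apply Rlt_le_trans with 0; [lra|]. apply Rle_div_r; lra.
    - intros x; rewrite Rmin_left, Rmax_right by lra; intros Hx; split.
      + auto_derive; [lra|]. field; lra.
      + apply (ex_derive_continuous (fun y => / (1 + y) ^ 2)). auto_derive. nra. }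
  assert (H2 : is_RInt (fun x => scal (- / (1 + x) ^ 2) (w (1 / (1 + x)))) 0 1
                 (RInt w (1 / (1 + 0)) (1 / (1 + 1)))).
  { apply (is_RInt_comp w (fun x => 1 / (1 + x)) (fun x => - / (1 + x) ^ 2)).
    - intros x; rewrite Rmin_left, Rmax_right by lra; intros Hx.
      apply Hw. apply Rlt_le_trans with 0; [lra|]. apply Rle_div_r; lra.
    - intros x; rewrite Rmin_left, Rmax_right by lra; intros Hx; split.
      + auto_derive; [lra|]. field; lra.
      + apply (ex_derive_continuous (fun y => - / (1 + y) ^ 2)). auto_derive. nra. }
  pose proof (is_RInt_minus _ _ _ _ _ _ H1 H2) as H.
  replace (0 / (1 + 0)) with 0 in H by field.
  replace (1 / (1 + 0)) with 1 in H by field.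
  replace (1 / (1 + 1)) with (/ 2) in H by field.
  rewrite <- (RInt_Chasles w 0 (/ 2) 1) by (apply Hex; lra).
  rewrite <- (opp_RInt_swap w (/ 2) 1) in H by (apply Hex; lra).
  unfold minus in H; rewrite opp_opp in H.
  revert H; apply is_RInt_ext; intros x _.
  unfold Pden, minus, plus, opp, scal; simpl; unfold mult; simpl.
  unfold Rdiv; ring.
Qed.

Lemma is_RInt_Pit n w : (forall x, continuous w x) ->
  is_RInt (Pit n w) 0 1 (RInt w 0 1).
Proof.
  intros Hw; induction n as [|n IH].
  - apply (RInt_correct w), (ex_RInt_continuous (V := R_CompleteNormedModule)).
    intros; apply Hw.
  - rewrite <- (is_RInt_unique _ _ _ _ IH).
    apply is_RInt_Pden with (d := / INR (S n)).
    + apply Rinv_0_lt_compat, lt_0_INR; lia.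
    + now apply Pit_continuous.
Qed.

Lemma is_RInt_ln1p a : 0 <= a -> is_RInt (fun x => a / (1 + a * x)) 0 1 (ln (1 + a)).
Proof.
  intros Ha.
  replace (ln (1 + a)) with (minus (ln (1 + a * 1)) (ln (1 + a * 0))).
  2: { unfold minus, plus, opp; simpl. rewrite Rmult_0_r, Rplus_0_r, ln_1, Rmult_1_r; ring. }
  apply (is_RInt_derive (fun x => ln (1 + a * x))).
  - intros x; rewrite Rmin_left, Rmax_right by lra; intros Hx.
    auto_derive; [nra|]. field; nra.
  - intros x; rewrite Rmin_left, Rmax_right by lra; intros Hx.
    apply (ex_derive_continuous (fun x => a / (1 + a * x))). auto_derive; nra.
Qed.

Lemma is_RInt_inv_sq a : 0 <= a -> is_RInt (fun x => / (1 + a * x) ^ 2) 0 1 (/ (1 + a)).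
Proof.
  intros Ha.
  replace (/ (1 + a)) with (minus (1 / (1 + a * 1)) (0 / (1 + a * 0))).
  2: { unfold minus, plus, opp; simpl. field; lra. }
  apply (is_RInt_derive (fun x => x / (1 + a * x))).
  - intros x; rewrite Rmin_left, Rmax_right by lra; intros Hx.
    auto_derive; [nra|]. field; nra.
  - intros x; rewrite Rmin_left, Rmax_right by lra; intros Hx.
    apply (ex_derive_continuous (fun x => / (1 + a * x) ^ 2)). auto_derive.
    assert (0 < 1 + a * x) by nra. nra.
Qed.

Section Cone.
Variables (u w : R -> R).
Hypothesis Hu : incr_concave u.
Hypothesis Huw : forall y, 0 <= y -> u y = y * w y.
Hypothesis Hw : forall y, 0 <= y <= 1 -> 0 <= w y <= 1.
Hypothesis Hwc : forall x, continuous w x.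

Let c n := Lit n u 1.
Let m := RInt w 0 1.

Lemma Pit_f11_bounds n x : 0 <= x <= 1 ->
  c (S n) / (1 + x) <= Pit n w (1 / (1 + x)) / (1 + x) ^ 2 <= c n / (1 + x).
Proof.
  intros Hx; pose proof (f11_bounds x Hx) as B.
  destruct (Lit_incr_concave_Y n u _ Hu B) as [H1 H2].
  rewrite (Lit_Pit n u w (1 / (1 + x))) in H1, H2 by (lra || easy).
  replace (Pit n w (1 / (1 + x)) / (1 + x) ^ 2)
    with ((1 / (1 + x) * Pit n w (1 / (1 + x))) / (1 + x)) by (field; lra).
  assert (0 < / (1 + x)) by (apply Rinv_0_lt_compat; lra).
  unfold Rdiv at 1 2 4; split; apply Rmult_le_compat_r; lra || easy.
Qed.

Lemma Pden_split n x : 0 <= x <= 1 ->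
  Pit (S n) w x = Pit n w (x / (1 + x)) / (1 + x) ^ 2 + Pit n w (1 / (1 + x)) / (1 + x) ^ 2.
Proof. intros Hx; rewrite Pit_S; unfold Pden; field; lra. Qed.

Lemma f10_bounds x : 0 <= x <= 1 -> 0 <= x / (1 + x) <= 1.
Proof. intros Hx; split; [apply Rle_div_r|apply Rle_div_l]; lra. Qed.

Lemma Lit_at1_bounds n : 0 <= c n <= 1.
Proof.
  assert (H : forall y, 0 < y <= 1 -> 0 <= u y <= 1).
  { intros y Hy; rewrite Huw by lra. pose proof (Hw y ltac:(lra)); nra. }
  unfold c; split.
  - apply Lit_ge0; [lra|]. intros y Hy; now apply H.
  - apply Rle_trans with (Lit n (fun _ => 1) 1); [|rewrite Lit_1; lra].
    apply Lit_le01; [lra|]. intros y Hy; now apply H.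
Qed.

Lemma Pit_lower n x : 0 <= x <= 1 -> c n * (INR n / (1 + INR n * x)) <= Pit n w x.
Proof.
  revert x; induction n as [|n IH]; intros x Hx.
  - simpl; unfold Rdiv; rewrite Rmult_0_l, Rmult_0_r; now apply Hw.
  - rewrite Pden_split by easy.
    destruct (Pit_f11_bounds n x Hx) as [H1 _].
    pose proof (f10_bounds x Hx) as B. pose proof (IH _ B) as H2.
    pose proof (pos_INR n) as Hn.
    pose proof (Lit_at1_decr n 1 u Hu) as Hd; rewrite Nat.add_1_r in Hd; fold (c (S n)) (c n) in Hd.
    assert (0 < (1 + x) ^ 2) by nra.
    assert (H3 : c (S n) * (INR n / (1 + INR n * (x / (1 + x)))) / (1 + x) ^ 2
                 <= Pit n w (x / (1 + x)) / (1 + x) ^ 2).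
    { apply Rmult_le_compat_r; [left; now apply Rinv_0_lt_compat|].
      apply Rle_trans with (2 := H2). apply Rmult_le_compat_r; [|easy].
      apply Rle_div_r; nra. }
    apply Rle_trans with (c (S n) * (INR n / (1 + INR n * (x / (1 + x)))) / (1 + x) ^ 2
                          + c (S n) / (1 + x)); [|lra].
    apply Req_le; rewrite S_INR; field; repeat split; nra.
Qed.

Lemma Pit_upper N B j x : (forall y, 0 <= y <= 1 -> Pit N w y <= B) -> 0 <= x <= 1 ->
  Pit (N + j) w x <= c N * (INR j / (1 + INR j * x)) + B * / (1 + INR j * x) ^ 2.
Proof.
  intros HB; revert x; induction j as [|j IH]; intros x Hx.
  - rewrite Nat.add_0_r; simpl.
    replace (c N * (0 / (1 + 0 * x)) + B * / ((1 + 0 * x) * ((1 + 0 * x) * 1)))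
      with B by field.
    now apply HB.
  - rewrite Nat.add_succ_r, Pden_split by easy.
    destruct (Pit_f11_bounds (N + j) x Hx) as [_ H1].
    pose proof (f10_bounds x Hx) as B'. pose proof (IH _ B') as H2.
    pose proof (pos_INR j) as Hn.
    pose proof (Lit_at1_decr N j u Hu) as Hd; fold (c (N + j)) (c N) in Hd.
    assert (0 < (1 + x) ^ 2) by nra.
    assert (0 < / (1 + x)) by (apply Rinv_0_lt_compat; lra).
    assert (H3 : c (N + j) / (1 + x) <= c N / (1 + x)) by (apply Rmult_le_compat_r; lra).
    apply Rmult_le_compat_r with (r := / (1 + x) ^ 2) in H2;
      [|left; now apply Rinv_0_lt_compat].
    eapply Rle_trans; [apply Rplus_le_compat; [exact H2|eapply Rle_trans; [exact H1|exact H3]]|].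
    apply Req_le; rewrite S_INR; field; repeat split; nra.
Qed.

Lemma Pit_linear_bound n x : 0 <= x <= 1 -> 0 <= Pit n w x <= INR n + 1.
Proof.
  revert x; induction n as [|n IH]; intros x Hx.
  - simpl; pose proof (Hw x Hx); lra.
  - rewrite Pden_split by easy.
    pose proof (Pit_f11_bounds n x Hx) as H1.
    pose proof (IH _ (f10_bounds x Hx)) as H2.
    pose proof (Lit_at1_bounds n); pose proof (Lit_at1_bounds (S n)).
    assert (Hi : 0 < / (1 + x) <= 1).
    { split; [apply Rinv_0_lt_compat; lra|].
      rewrite <- Rinv_1; apply Rinv_le_contravar; lra. }
    assert (Hi2 : 0 < / (1 + x) ^ 2 <= 1).
    { split; [apply Rinv_0_lt_compat; nra|].
      rewrite <- Rinv_1; apply Rinv_le_contravar; nra. }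
    unfold Rdiv in *; rewrite S_INR.
    pose proof (pos_INR n). split; nra.
Qed.

Lemma Lit_at1_upper n : c n * ln (1 + INR n) <= m.
Proof.
  pose proof (is_RInt_scal _ 0 1 (c n) _ (is_RInt_ln1p (INR n) (pos_INR n))) as H.
  apply (is_RInt_le _ _ _ _ _ _ Rle_0_1 H (is_RInt_Pit n w Hwc)).
  intros x Hx; apply Pit_lower; lra.
Qed.

Lemma Lit_at1_lower N j : m <= c N * ln (1 + INR j) + (INR N + 1) / (1 + INR j).
Proof.
  pose proof (is_RInt_scal _ 0 1 (c N) _ (is_RInt_ln1p (INR j) (pos_INR j))) as H1.
  pose proof (is_RInt_scal _ 0 1 (INR N + 1) _ (is_RInt_inv_sq (INR j) (pos_INR j))) as H2.
  apply (is_RInt_le _ _ _ _ _ _ Rle_0_1 (is_RInt_Pit (N + j) w Hwc) (is_RInt_plus _ _ _ _ _ _ H1 H2)).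
  intros x Hx; apply Pit_upper; [|lra]. intros y Hy; now apply Pit_linear_bound.
Qed.

(* Taking [j + 1 = (N + 1) K] costs only [ln K] in the logarithm. *)
Lemma Lit_at1_lower_scaled N K : (0 < K)%nat ->
  m <= c N * (ln (1 + INR N) + ln (INR K)) + / INR K.
Proof.
  intros HK.
  assert (HK' : 0 < INR K) by now apply lt_0_INR.
  pose proof (pos_INR N).
  pose proof (Lit_at1_lower N (S N * K - 1)) as H0.
  assert (E : 1 + INR (S N * K - 1) = (1 + INR N) * INR K).
  { rewrite minus_INR by nia. rewrite mult_INR, S_INR; simpl; ring. }
  rewrite E, ln_mult in H0 by lra.
  replace ((INR N + 1) / ((1 + INR N) * INR K)) with (/ INR K) in H0 by (field; lra).
  easy.
Qed.

Lemma Lit_cone_bound n x : / 2 <= x <= 1 -> 0 <= Lit n u x /\ ln (1 + INR n) * Lit n u x <= m.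
Proof.
  intros Hx.
  destruct (Lit_incr_concave_Y n u x Hu Hx) as [H1 H2].
  pose proof (Lit_at1_bounds (S n)) as B; unfold c in B.
  pose proof (Lit_at1_upper n) as U; unfold c in U.
  assert (0 <= ln (1 + INR n)).
  { rewrite <- ln_1; apply ln_le; pose proof (pos_INR n); lra. }
  split; [lra|nra].
Qed.

Lemma Lit_cone_limit x : / 2 <= x <= 1 ->
  is_lim_seq (fun n => ln (INR n) * Lit n u x) m.
Proof.
  intros Hx; apply is_lim_seq_spec; intros eps; unfold eventually; simpl.
  assert (Hm : 0 <= m).
  { pose proof (Lit_at1_upper 0) as H; simpl in H; rewrite Rplus_0_r, ln_1 in H; lra. }
  destruct (nfloor_ex (4 / eps)) as [K0 HK0].
  { left; apply Rdiv_lt_0_compat; [lra|apply cond_pos]. }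
  set (K := S K0).
  assert (HK : 0 < INR K) by (apply lt_0_INR; unfold K; lia).
  assert (HKe : / INR K < eps / 4).
  { replace (eps / 4) with (/ (4 / eps)) by (field; destruct eps; simpl; lra).
    apply Rinv_lt_contravar; unfold K; rewrite S_INR; [|lra].
    apply Rmult_lt_0_compat; [apply Rdiv_lt_0_compat; [lra|apply cond_pos]|].
    pose proof (pos_INR K0); lra. }
  assert (HlK : 0 <= ln (INR K)).
  { rewrite <- ln_1; apply ln_le; [lra|].
    unfold K; rewrite S_INR; pose proof (pos_INR K0); lra. }
  set (A := 4 * (m + 1) * (ln (INR K) + 1) / eps).
  assert (HA : 0 < A).
  { unfold A; apply Rdiv_lt_0_compat; [nra|apply cond_pos]. }
  destruct (nfloor_ex (exp A)) as [N0 HN0]; [left; apply exp_pos|].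
  exists (S N0); intros n Hn.
  destruct (Lit_incr_concave_Y n u x Hu Hx) as [H1 H2].
  fold (c n) (c (S n)) in H1, H2.
  pose proof (Lit_at1_upper n) as U.
  pose proof (Lit_at1_upper (S n)) as U1.
  pose proof (Lit_at1_lower_scaled (S n) K ltac:(unfold K; lia)) as Lw.
  pose proof (Lit_at1_bounds n) as B. pose proof (Lit_at1_bounds (S n)) as B1.
  apply le_INR in Hn; rewrite S_INR in Hn.
  assert (Hn0 : 1 < INR n) by (pose proof (exp_ineq1 A ltac:(lra)); lra).
  assert (Hln : A <= ln (INR n)).
  { rewrite <- (ln_exp A); apply ln_le; [apply exp_pos|lra]. }
  assert (Hl1 : ln (INR n) <= ln (1 + INR n)) by (apply ln_le; lra).
  assert (Hl2 : ln (1 + INR (S n)) <= ln (INR n) + 2).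
  { rewrite S_INR.
    apply Rle_trans with (ln (INR n * exp 2)).
    - apply ln_le; [lra|]. pose proof (exp_ineq1 2 ltac:(lra)); nra.
    - rewrite ln_mult, ln_exp by (try apply exp_pos; lra); lra. }
  assert (Hl3 : 0 <= ln (1 + INR (S n)) - ln (INR n)).
  { assert (ln (INR n) <= ln (1 + INR (S n))); [apply ln_le; rewrite ?S_INR; lra|lra]. }
  assert (Hc : c (S n) * (ln (INR K) + 2) <= eps / 2).
  { assert (Hd : 0 < eps) by apply cond_pos.
    assert (EA : A * eps = 4 * (m + 1) * (ln (INR K) + 1)) by (unfold A; field; lra).
    assert (HcA : c (S n) * A <= m) by nra.
    apply Rmult_le_reg_r with (m + 1); [lra|].
    assert (c (S n) * A * eps <= m * eps) by (apply Rmult_le_compat_r; lra).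
    nra. }
  apply Rabs_lt_between; split.
  - nra.
  - assert (ln (INR n) * Lit n u x <= c n * ln (1 + INR n)); [|destruct eps; simpl in *; lra].
    rewrite (Rmult_comm (c n)). apply Rmult_le_compat; nra.
Qed.

End Cone.

(** * Indicators of intervals *)

Definition phi (c x : R) : R := Rmin x c.
Definition phi_dens (c x : R) : R := c / Rmax x c.

Lemma phi_incr_concave c : incr_concave (phi c).
Proof.
  unfold phi; split.
  - intros x y _ Hxy _. unfold Rmin; destruct (Rle_dec x c), (Rle_dec y c); lra.
  - intros x y l _ _ Hl.
    apply Rmin_glb.
    + apply Rplus_le_compat; apply Rmult_le_compat_l; try lra; apply Rmin_l.
    + pose proof (Rmin_r x c); pose proof (Rmin_r y c); nra.
Qed.

Lemma phi_phi_dens c y : 0 < c -> 0 <= y -> phi c y = y * phi_dens c y.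
Proof.
  intros Hc Hy; unfold phi, phi_dens, Rmin, Rmax.
  destruct (Rle_dec y c); field; lra.
Qed.

Lemma phi_dens_bounds c y : 0 < c -> 0 <= phi_dens c y <= 1.
Proof.
  intros Hc; unfold phi_dens. pose proof (Rmax_r y c). split.
  - apply Rle_div_r; lra.
  - apply Rle_div_l; lra.
Qed.

Lemma phi_dens_continuous c x : 0 < c -> continuous (phi_dens c) x.
Proof.
  intros Hc; unfold phi_dens. pose proof (Rmax_r x c).
  apply (continuous_comp (fun x => Rmax x c) (fun y => c / y)).
  - apply continuous_ext with (fun x => (x + c + Rabs (x - c)) / 2).
    { intros y; unfold Rmax, Rabs; destruct (Rle_dec y c), (Rcase_abs (y - c)); lra. }
    apply (continuous_mult (fun x => x + c + Rabs (x - c)) (fun _ => / 2));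
      [|apply continuous_const].
    apply (continuous_plus (fun x => x + c) (fun x => Rabs (x - c))).
    + apply (continuous_plus (fun x => x) (fun _ => c));
        [apply continuous_id|apply continuous_const].
    + apply (continuous_comp (fun x => x - c) Rabs).
      * apply (continuous_minus (fun x => x) (fun _ => c));
        [apply continuous_id|apply continuous_const].
      * apply continuous_Rabs.
  - apply (ex_derive_continuous (fun y => c / y)). auto_derive. lra.
Qed.

Lemma RInt_phi_dens c : 0 < c <= 1 -> RInt (phi_dens c) 0 1 = c - c * ln c.
Proof.
  intros Hc; apply is_RInt_unique.
  replace (c - c * ln c) with (plus (scal (c - 0) 1) (minus (c * ln 1) (c * ln c))).
  2: { unfold plus, minus, plus, opp, scal; simpl; unfold mult; simpl; rewrite ln_1; ring. }
  apply (is_RInt_Chasles (phi_dens c) 0 c 1).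
  - apply is_RInt_ext with (fun _ => 1); [|apply (is_RInt_const (V := R_NormedModule))].
    intros x; rewrite Rmin_left, Rmax_right by lra; intros Hx.
    unfold phi_dens; rewrite Rmax_right by lra; change (1 = c / c); field; lra.
  - apply is_RInt_ext with (fun x => c / x).
    + intros x; rewrite Rmin_left, Rmax_right by lra; intros Hx.
      unfold phi_dens; rewrite Rmax_left by lra; easy.
    + apply (is_RInt_derive (fun x => c * ln x)).
      * intros x; rewrite Rmin_left, Rmax_right by lra; intros Hx.
        auto_derive; [lra|]. field; lra.
      * intros x; rewrite Rmin_left, Rmax_right by lra; intros Hx.
        apply (ex_derive_continuous (fun x => c / x)). auto_derive; lra.
Qed.

Lemma phi_limit c x : 0 < c <= 1 -> / 2 <= x <= 1 ->
  is_lim_seq (fun n => ln (INR n) * Lit n (phi c) x) (c - c * ln c).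
Proof.
  intros Hc Hx; rewrite <- RInt_phi_dens by easy.
  apply Lit_cone_limit; try easy.
  - apply phi_incr_concave.
  - intros y Hy; apply phi_phi_dens; lra.
  - intros y _; apply phi_dens_bounds; lra.
  - intros y; apply phi_dens_continuous; lra.
Qed.

Definition heaviside (p y : R) : R := if Rle_dec p y then 1 else 0.

Definition ramp (a b y : R) : R := / (b - a) * (phi b y - phi a y).

Lemma ramp_le_heaviside p b y : p < b -> ramp p b y <= heaviside p y.
Proof.
  intros Hb; assert (0 < / (b - p)) by (apply Rinv_0_lt_compat; lra).
  unfold ramp, heaviside, phi. destruct (Rle_dec p y) as [H1|H1].
  - apply Rmult_le_reg_l with (b - p); [lra|].
    rewrite <- Rmult_assoc, Rinv_r, Rmult_1_l, Rmult_1_r by lra.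
    unfold Rmin; destruct (Rle_dec y b), (Rle_dec y p); lra.
  - rewrite !Rmin_left by lra; lra.
Qed.

Lemma heaviside_le_ramp a p y : a < p -> heaviside p y <= ramp a p y.
Proof.
  intros Ha; assert (0 < / (p - a)) by (apply Rinv_0_lt_compat; lra).
  unfold ramp, heaviside, phi. destruct (Rle_dec p y) as [H1|H1].
  - rewrite !Rmin_right by lra; apply Req_le; field; lra.
  - apply Rmult_le_pos; [lra|].
    unfold Rmin; destruct (Rle_dec y a), (Rle_dec y p); lra.
Qed.

Lemma ramp_limit a b x : 0 < a -> a < b -> b <= 1 -> / 2 <= x <= 1 ->
  is_lim_seq (fun n => ln (INR n) * Lit n (ramp a b) x)
    (/ (b - a) * ((b - b * ln b) - (a - a * ln a))).
Proof.
  intros Ha Hab Hb Hx.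
  apply is_lim_seq_ext with
    (fun n => / (b - a) * (ln (INR n) * Lit n (phi b) x - ln (INR n) * Lit n (phi a) x)).
  { intros n; unfold ramp; rewrite (Lit_scal n (/ (b - a)) (fun y => phi b y - phi a y)).
    rewrite Lit_minus; ring. }
  apply (is_lim_seq_scal_l _ (/ (b - a)) (Finite (b - b * ln b - (a - a * ln a)))).
  apply is_lim_seq_minus'; apply phi_limit; lra.
Qed.

Lemma ln_ratio_bounds a b : 0 < a -> a <= b ->
  (b - a) / b <= ln b - ln a <= (b - a) / a.
Proof.
  intros Ha Hab.
  assert (H : forall p q, 0 < p -> 0 < q -> ln q - ln p <= (q - p) / p).
  { intros p q Hp Hq. rewrite <- ln_div by easy.
    assert (0 < q / p) by now apply Rdiv_lt_0_compat.
    assert (1 + ln (q / p) <= q / p).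
    { rewrite <- (exp_ln (q / p)) at 2 by easy.
      destruct (Req_dec (ln (q / p)) 0) as [->|E]; [rewrite exp_0; lra|].
      left; now apply exp_ineq1. }
    replace ((q - p) / p) with (q / p - 1) by (field; lra). lra. }
  split; [|apply H; lra].
  pose proof (H b a ltac:(lra) Ha).
  replace ((a - b) / b) with (- ((b - a) / b)) in H0 by (field; lra). lra.
Qed.

Lemma ramp_mass a b : 0 < a -> a < b ->
  - ln b <= / (b - a) * ((b - b * ln b) - (a - a * ln a)) <= - ln a.
Proof.
  intros Ha Hab; destruct (ln_ratio_bounds a b Ha ltac:(lra)) as [H1 H2].
  assert (K1 : b - a <= (ln b - ln a) * b) by (apply Rle_div_l in H1; lra).
  assert (K2 : (ln b - ln a) * a <= b - a) by (apply Rle_div_r in H2; lra).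
  split; apply Rmult_le_reg_l with (b - a); try lra;
    rewrite <- Rmult_assoc, Rinv_r, Rmult_1_l by lra; nra.
Qed.

Lemma INR_eventually_ge1 : eventually (fun n => 1 <= INR n).
Proof. exists 1%nat; intros n Hn; apply (le_INR 1); lia. Qed.

Lemma ln_INR_nonneg n : 1 <= INR n -> 0 <= ln (INR n).
Proof. intros H; rewrite <- ln_1; apply ln_le; lra. Qed.

Lemma heaviside_limit p x : 0 < p <= 1 -> / 2 <= x <= 1 ->
  is_lim_seq (fun n => ln (INR n) * Lit n (heaviside p) x) (- ln p).
Proof.
  intros Hp Hx; apply is_lim_seq_spec; intros eps.
  assert (He : 0 < eps) by apply cond_pos.
  assert (Hh : 0 < eps / 2) by lra.
  assert (Hup : eventually (fun n => ln (INR n) * Lit n (heaviside p) x < - ln p + eps)).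
  { set (a := p * exp (- (eps / 2))).
    assert (Ha : 0 < a < p).
    { pose proof (exp_pos (- (eps / 2))).
      assert (exp (- (eps / 2)) < 1) by (rewrite <- exp_0; apply exp_increasing; lra).
      unfold a; nra. }
    pose proof (ramp_limit a p x ltac:(lra) ltac:(lra) ltac:(lra) Hx) as L.
    apply is_lim_seq_spec in L.
    apply (filter_imp _ _) with (2 := filter_and _ _ INR_eventually_ge1 (L (mkposreal _ Hh))).
    intros n [H1 Hn]; simpl in Hn; apply Rabs_lt_between in Hn.
    pose proof (ramp_mass a p ltac:(lra) ltac:(lra)) as [_ Hm].
    assert (Ela : ln a = ln p - eps / 2).
    { unfold a; rewrite ln_mult, ln_exp by (try apply exp_pos; lra); lra. }
    assert (ln (INR n) * Lit n (heaviside p) x <= ln (INR n) * Lit n (ramp a p) x); [|lra].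
    apply Rmult_le_compat_l; [now apply ln_INR_nonneg|].
    apply Lit_le01; [lra|]. intros y _; apply heaviside_le_ramp; lra. }
  assert (Hlo : eventually (fun n => - ln p - eps < ln (INR n) * Lit n (heaviside p) x)).
  { destruct (Req_dec p 1) as [->|Hp1].
    - apply (filter_imp _ _) with (2 := INR_eventually_ge1). intros n Hn.
      rewrite ln_1.
      assert (0 <= ln (INR n) * Lit n (heaviside 1) x); [|lra].
      apply Rmult_le_pos; [now apply ln_INR_nonneg|].
      apply Lit_ge0; [lra|]. intros y _; unfold heaviside; destruct (Rle_dec 1 y); lra.
    - set (b := Rmin 1 (p * exp (eps / 2))).
      assert (Hb : p < b <= 1).
      { split; [|apply Rmin_l]. unfold b; apply Rmin_glb_lt; [lra|].
        assert (1 < exp (eps / 2)) by (rewrite <- exp_0; apply exp_increasing; lra). nra. }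
      pose proof (ramp_limit p b x ltac:(lra) ltac:(lra) ltac:(lra) Hx) as L.
      apply is_lim_seq_spec in L.
      apply (filter_imp _ _) with (2 := filter_and _ _ INR_eventually_ge1 (L (mkposreal _ Hh))).
      intros n [H1 Hn]; simpl in Hn; apply Rabs_lt_between in Hn.
      pose proof (ramp_mass p b ltac:(lra) ltac:(lra)) as [Hm _].
      assert (Ela : ln b <= ln p + eps / 2).
      { rewrite <- (ln_exp (eps / 2)), <- ln_mult by (try apply exp_pos; lra).
        apply ln_le; [lra|apply Rmin_r]. }
      assert (ln (INR n) * Lit n (ramp p b) x <= ln (INR n) * Lit n (heaviside p) x); [|lra].
      apply Rmult_le_compat_l; [now apply ln_INR_nonneg|].
      apply Lit_le01; [lra|]. intros y _; apply ramp_le_heaviside; lra. }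
  apply (filter_imp _ _) with (2 := filter_and _ _ Hup Hlo).
  intros n [H1 H2]; apply Rabs_lt_between; lra.
Qed.

Lemma heaviside_half_bound n x : / 2 <= x <= 1 ->
  0 <= Lit n (heaviside (/ 2)) x <= 1 /\ ln (1 + INR n) * Lit n (heaviside (/ 2)) x <= 2.
Proof.
  intros Hx; split; [split|].
  - apply Lit_ge0; [lra|]. intros y _; unfold heaviside; destruct (Rle_dec (/ 2) y); lra.
  - apply Rle_trans with (Lit n (fun _ => 1) x); [|rewrite Lit_1; lra].
    apply Lit_le01; [lra|]. intros y _; unfold heaviside; destruct (Rle_dec (/ 2) y); lra.
  - destruct (Lit_cone_bound (phi 1) (phi_dens 1) (phi_incr_concave 1)
      (fun y Hy => phi_phi_dens 1 y Rlt_0_1 Hy) (fun y _ => phi_dens_bounds 1 y Rlt_0_1)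
      (fun y => phi_dens_continuous 1 y Rlt_0_1) n x Hx) as [_ H].
    rewrite RInt_phi_dens, ln_1 in H by lra.
    assert (Lit n (heaviside (/ 2)) x <= 2 * Lit n (phi 1) x).
    { rewrite <- Lit_scal. apply Lit_le01; [lra|].
      intros y Hy; unfold heaviside, phi, Rmin.
      destruct (Rle_dec (/ 2) y), (Rle_dec y 1); lra. }
    assert (0 <= ln (1 + INR n)).
    { rewrite <- ln_1; apply ln_le; pose proof (pos_INR n); lra. }
    nra.
Qed.

(** * Gauge-fine Riemann sums *)

Lemma cousin (Q : R -> R -> Prop) a b : a <= b ->
  (forall p q r, a <= p -> p <= q -> q <= r -> r <= b -> Q p q -> Q q r -> Q p r) ->
  (forall t, a <= t <= b -> exists d, 0 < d /\
     forall p q, a <= p -> p <= t -> t <= q -> q <= b -> t - d < p -> q < t + d -> Q p q) ->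
  Q a b.
Proof.
  intros Hab Htr Hloc.
  set (E := fun x => a <= x <= b /\ Q a x).
  assert (Ea : E a).
  { split; [lra|]. destruct (Hloc a ltac:(lra)) as [d [Hd H]]. apply H; lra. }
  destruct (completeness E) as [s [Hs1 Hs2]].
  { exists b; intros x [Hx _]; lra. }
  { now exists a. }
  assert (Has : a <= s) by now apply Hs1.
  assert (Hsb : s <= b) by (apply Hs2; intros x [Hx _]; lra).
  destruct (Hloc s ltac:(lra)) as [d [Hd H]].
  assert (Hx : exists x, E x /\ s - d < x).
  { destruct (classic (exists x, E x /\ s - d < x)) as [|Hn]; [easy|].
    assert (s <= s - d); [|lra].
    apply Hs2; intros x Ex. destruct (Rle_dec x (s - d)); [easy|].
    exfalso; apply Hn; exists x; split; [easy|lra]. }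
  destruct Hx as [x [Ex Hx]].
  assert (Hxs : x <= s) by now apply Hs1.
  destruct Ex as [Hx' Qx].
  set (q := Rmin b (s + d / 2)).
  assert (Hq : q <= b /\ q <= s + d / 2) by (split; [apply Rmin_l|apply Rmin_r]).
  assert (Hsq : s <= q) by (apply Rmin_glb; lra).
  assert (Eq : E q).
  { split; [lra|]. apply (Htr a x q); try lra; [easy|]. apply H; lra. }
  assert (q <= s) by now apply Hs1.
  assert (q = b); [|subst q; destruct Eq; congruence].
  unfold q, Rmin in *; destruct (Rle_dec b (s + d / 2)); lra.
Qed.

Definition riemann_sum (delta : R -> R) (g : R -> R) (a b s : R) : Prop :=
  exists (n : nat) (p t : nat -> R),
    p O = a /\ p n = b /\
    (forall i, (i < n)%nat ->
       p i <= t i <= p (S i) /\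
       t i - delta (t i) < p i /\ p (S i) < t i + delta (t i)) /\
    s = Rsum (fun i => g (t i) * (p (S i) - p i)) n.

Lemma Rsum_ext u v n : (forall i, (i < n)%nat -> u i = v i) -> Rsum u n = Rsum v n.
Proof.
  induction n as [|n IH]; intros H; simpl; [easy|].
  rewrite IH, H by (intros; (apply H; lia) || lia); easy.
Qed.

Lemma Rsum_app u n k : Rsum u (n + k) = Rsum u n + Rsum (fun i => u (n + i)%nat) k.
Proof.
  induction k as [|k IH]; simpl; [rewrite Nat.add_0_r; ring|].
  rewrite Nat.add_succ_r; simpl; rewrite IH; ring.
Qed.

Lemma riemann_sum_single delta g a b t : a <= t <= b ->
  t - delta t < a -> b < t + delta t -> riemann_sum delta g a b (g t * (b - a)).
Proof.
  intros Ht H1 H2.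
  exists 1%nat, (fun i => match i with O => a | _ => b end), (fun _ => t).
  split; [easy|split; [easy|split; [|simpl; ring]]].
  intros [|i] Hi; [|lia]. split; [easy|split; easy].
Qed.

Lemma riemann_sum_trans delta g a b c S1 S2 :
  riemann_sum delta g a b S1 -> riemann_sum delta g b c S2 ->
  riemann_sum delta g a c (S1 + S2).
Proof.
  intros [n [p [t [Ha [Hb [Hp ->]]]]]] [k [p' [t' [Ha' [Hc [Hp' ->]]]]]].
  set (P := fun i => if le_lt_dec n i then p' (i - n)%nat else p i).
  set (T := fun i => if le_lt_dec n i then t' (i - n)%nat else t i).
  assert (P1 : forall i, (i <= n)%nat -> P i = p i).
  { intros i Hi; unfold P; destruct (le_lt_dec n i) as [H|]; [|easy].
    replace i with n by lia. rewrite Nat.sub_diag; congruence. }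
  assert (P2 : forall i, P (n + i)%nat = p' i).
  { intros i; unfold P; destruct (le_lt_dec n (n + i)) as [H|]; [|lia].
    f_equal; lia. }
  assert (T1 : forall i, (i < n)%nat -> T i = t i).
  { intros i Hi; unfold T; destruct (le_lt_dec n i) as [H|]; [lia|easy]. }
  assert (T2 : forall i, T (n + i)%nat = t' i).
  { intros i; unfold T; destruct (le_lt_dec n (n + i)) as [H|]; [|lia].
    f_equal; lia. }
  exists (n + k)%nat, P, T; split; [|split; [|split]].
  - rewrite P1 by lia; easy.
  - rewrite P2; easy.
  - intros i Hi; destruct (le_lt_dec n i) as [H|H].
    + replace i with (n + (i - n))%nat by lia.
      rewrite <- Nat.add_succ_r, !P2, !T2. apply Hp'; lia.
    + rewrite !P1, T1 by lia. now apply Hp.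
  - rewrite Rsum_app; f_equal; apply Rsum_ext.
    + intros i Hi; now rewrite !P1, T1 by lia.
    + intros i Hi; now rewrite <- Nat.add_succ_r, !P2, T2.
Qed.

Lemma HK_integral_riemann_sum g a b I eps : HK_integral g a b I -> 0 < eps ->
  exists delta : R -> R, (forall t, 0 < delta t) /\
    forall S, riemann_sum delta g a b S -> Rabs (S - I) < eps.
Proof.
  intros H He; destruct (H eps He) as [delta [Hd Hs]].
  exists delta; split; [easy|].
  intros S [n [p [t [Ha [Hb [Hp ->]]]]]]. now apply Hs.
Qed.

Definition ind (a b y : R) : R := heaviside a y - heaviside b y.

Lemma ind_cases a b y : a <= b ->
  (a <= y < b /\ ind a b y = 1) \/ (~ (a <= y < b) /\ ind a b y = 0).
Proof.
  intros Hab; unfold ind, heaviside.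
  destruct (Rle_dec a y), (Rle_dec b y); lra.
Qed.

Lemma ind_limit a b x : 0 < a -> a <= b -> b <= 1 -> / 2 <= x <= 1 ->
  is_lim_seq (fun n => ln (INR n) * Lit n (ind a b) x) (ln b - ln a).
Proof.
  intros Ha Hab Hb Hx.
  apply is_lim_seq_ext with
    (fun n => ln (INR n) * Lit n (heaviside a) x - ln (INR n) * Lit n (heaviside b) x).
  { intros n; unfold ind; rewrite Lit_minus; ring. }
  replace (ln b - ln a) with (- ln a - - ln b) by ring.
  apply is_lim_seq_minus'; apply heaviside_limit; lra.
Qed.

Definition variation_dominated (f W : R -> R) (a b : R) : Prop :=
  forall p q, a <= p -> p <= q -> q <= b -> Rabs (f q - f p) <= W q - W p.

Lemma ind_oscillation f W a b p q t x n : variation_dominated f W a b ->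
  a <= p -> p <= t -> t <= q -> q <= b -> 0 < x <= 1 ->
  Rabs (Lit n (fun y => f y * ind p q y) x - f t * Lit n (ind p q) x)
    <= (W q - W p) * Lit n (ind p q) x.
Proof.
  intros HW Hp Hpt Htq Hq Hx.
  rewrite <- !Lit_scal, <- Lit_minus.
  apply Lit_abs_le; [easy|]. intros y _.
  destruct (ind_cases p q y ltac:(lra)) as [[Hy ->]|[_ ->]].
  2: { rewrite !Rmult_0_r, Rminus_0_r, Rabs_R0; lra. }
  rewrite !Rmult_1_r.
  assert (M : forall r s, p <= r -> r <= s -> s <= q -> Rabs (f s - f r) <= W q - W p).
  { intros r s Hr Hrs Hs.
    pose proof (HW p r ltac:(lra) ltac:(lra) ltac:(lra)).
    pose proof (HW r s ltac:(lra) ltac:(lra) ltac:(lra)).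
    pose proof (HW s q ltac:(lra) ltac:(lra) ltac:(lra)).
    pose proof (Rabs_pos (f r - f p)); pose proof (Rabs_pos (f q - f s)). lra. }
  destruct (Rle_dec t y); [apply M; lra|].
  rewrite Rabs_minus_sym; apply M; lra.
Qed.

Lemma riemann_sum_approx (f W delta : R -> R) (eta M kappa x : R) :
  0 < eta < 1 -> (forall y, eta <= y <= 1 -> Rabs (f y) <= M) ->
  variation_dominated f W eta 1 ->
  (forall t, 0 < delta t) -> 0 < kappa -> / 2 <= x <= 1 ->
  exists S, riemann_sum delta (fun y => f y * / y) eta 1 S /\
    eventually (fun n => Rabs (ln (INR n) * Lit n (fun y => f y * ind eta 1 y) x - S)
                         <= kappa * ((1 - eta) + (W 1 - W eta))).
Proof.
  intros Heta HM HW Hdelta Hk Hx.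
  apply (cousin (fun a b => exists S, riemann_sum delta (fun y => f y * / y) a b S /\
    eventually (fun n => Rabs (ln (INR n) * Lit n (fun y => f y * ind a b y) x - S)
                         <= kappa * ((b - a) + (W b - W a))))); [lra| |].
  - intros p q r Hp Hpq Hqr Hr [S1 [R1 E1]] [S2 [R2 E2]].
    exists (S1 + S2); split; [eapply riemann_sum_trans; eassumption|].
    apply (filter_imp _ _) with (2 := filter_and _ _ E1 E2).
    intros n [H1 H2].
    rewrite (Lit_ext n (fun y => f y * ind p r y)
               (fun y => f y * ind p q y + f y * ind q r y)), Lit_plus;
      [|lra|intros y _; unfold ind; ring].
    match goal with |- Rabs ?z <= _ => match type of H1 with Rabs ?z1 <= _ =>
      match type of H2 with Rabs ?z2 <= _ => replace z with (z1 + z2) by ring end end end.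
    eapply Rle_trans; [apply Rabs_triang|]. lra.
  - intros t Ht.
    assert (HM0 : 0 <= M) by (eapply Rle_trans; [apply Rabs_pos|apply (HM t Ht)]).
    set (d0 := Rmin (kappa * eta / 4) (kappa * eta ^ 2 / (4 * (M + 1)))).
    assert (Hd0 : 0 < d0).
    { apply Rmin_glb_lt; apply Rdiv_lt_0_compat; try nra.
      apply Rmult_lt_0_compat; [lra|nra]. }
    exists (Rmin (delta t) d0); split; [now apply Rmin_glb_lt|].
    intros p q Hp Hpt Htq Hq H1 H2.
    pose proof (Rmin_l (delta t) d0); pose proof (Rmin_r (delta t) d0).
    exists (f t * / t * (q - p)); split.
    { apply (riemann_sum_single delta (fun y => f y * / y)); lra. }
    destruct (Req_dec p q) as [->|Hpq].
    { apply filter_forall; intros n.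
      rewrite (Lit_ext n _ (fun _ => 0)), Lit_0;
        [|lra|intros y _; unfold ind; ring].
      replace (ln (INR n) * 0 - f t * / t * (q - q)) with 0 by ring.
      rewrite Rabs_R0; lra. }
    set (L := ln q - ln p).
    set (e := Rmin (kappa / 2) (kappa * (q - p) / (2 * (M + 1)))).
    assert (He : 0 < e).
    { apply Rmin_glb_lt; [lra|apply Rdiv_lt_0_compat; nra]. }
    pose proof (ind_limit p q x ltac:(lra) ltac:(lra) ltac:(lra) Hx) as Lim.
    apply is_lim_seq_spec in Lim.
    apply (filter_imp _ _) with (2 := filter_and _ _ INR_eventually_ge1 (Lim (mkposreal e He))).
    intros n [Hn1 Hn]; simpl in Hn; fold L in Hn.
    pose proof (ind_oscillation f W eta 1 p q t x n HW Hp Hpt Htq Hq ltac:(lra)) as Osc.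
    apply Rmult_le_compat_l with (r := ln (INR n)) in Osc; [|now apply ln_INR_nonneg].
    rewrite <- (Rabs_pos_eq (ln (INR n))) in Osc at 1 by now apply ln_INR_nonneg.
    rewrite <- Rabs_mult in Osc.
    set (A := ln (INR n) * Lit n (ind p q) x) in *.
    set (F := Lit n (fun y => f y * ind p q y) x) in *.
    assert (Osc' : Rabs (ln (INR n) * F - f t * A) <= (W q - W p) * A).
    { unfold A; match goal with |- Rabs ?z <= ?b => match type of Osc with Rabs ?z' <= ?b' =>
        replace z with z' by ring; replace b with b' by ring end end. exact Osc. }
    clear Osc.
    assert (HWpq : 0 <= W q - W p).
    { eapply Rle_trans; [apply Rabs_pos|apply (HW p q); lra]. }
    destruct (ln_ratio_bounds p q ltac:(lra) ltac:(lra)) as [L1 L2]; fold L in L1, L2.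
    assert (Hqp : q - p < 2 * d0) by lra.
    assert (D1 : 2 * d0 <= kappa * eta / 2).
    { pose proof (Rmin_l (kappa * eta / 4) (kappa * eta ^ 2 / (4 * (M + 1)))); unfold d0; lra. }
    assert (D2 : 2 * d0 * (M + 1) <= kappa * eta ^ 2 / 2).
    { pose proof (Rmin_r (kappa * eta / 4) (kappa * eta ^ 2 / (4 * (M + 1)))) as Hr.
      fold d0 in Hr. apply Rle_div_r in Hr; lra. }
    assert (E1 : e <= kappa / 2) by apply Rmin_l.
    assert (E2 : e * (M + 1) <= kappa * (q - p) / 2).
    { pose proof (Rmin_r (kappa / 2) (kappa * (q - p) / (2 * (M + 1)))) as Hr.
      fold e in Hr. apply Rle_div_r in Hr; lra. }
    apply Rabs_lt_between in Hn.
    assert (HA : A <= kappa).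
    { assert (L <= kappa / 2); [|lra].
      apply Rle_trans with (1 := L2). apply Rle_div_l; nra. }
    assert (T1 : (q - p) / q <= (q - p) / t).
    { apply Rmult_le_compat_l; [lra|apply Rinv_le_contravar; lra]. }
    assert (T2 : (q - p) / t <= (q - p) / p).
    { apply Rmult_le_compat_l; [lra|apply Rinv_le_contravar; lra]. }
    assert (T3 : (q - p) / p - (q - p) / q <= (q - p) ^ 2 / eta ^ 2).
    { replace ((q - p) / p - (q - p) / q) with ((q - p) ^ 2 / (p * q)) by (field; lra).
      apply Rmult_le_compat_l; [apply pow2_ge_0|]. apply Rinv_le_contravar; nra. }
    assert (T4 : (q - p) ^ 2 / eta ^ 2 * (M + 1) <= kappa * (q - p) / 2).
    { replace ((q - p) ^ 2 / eta ^ 2 * (M + 1)) with ((q - p) * ((q - p) * (M + 1)) / eta ^ 2)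
        by (field; lra).
      apply Rle_div_l; [nra|].
      replace (kappa * (q - p) / 2 * eta ^ 2) with ((q - p) * (kappa * eta ^ 2 / 2)) by field.
      apply Rmult_le_compat_l; [lra|]. nra. }
    assert (T5 : Rabs (A - (q - p) / t) <= e + (q - p) ^ 2 / eta ^ 2).
    { apply Rabs_le; lra. }
    replace (ln (INR n) * F - f t * / t * (q - p))
      with ((ln (INR n) * F - f t * A) + f t * (A - (q - p) / t)) by (field; lra).
    eapply Rle_trans; [apply Rabs_triang|]. rewrite (Rabs_mult (f t)).
    pose proof (HM t Ht) as HMt. pose proof (Rabs_pos (f t)).
    pose proof (Rabs_pos (A - (q - p) / t)).
    assert (B1 : (W q - W p) * A <= kappa * (W q - W p)) by nra.
    assert (B2 : Rabs (f t) * Rabs (A - (q - p) / t)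
                 <= (M + 1) * (e + (q - p) ^ 2 / eta ^ 2)).
    { apply Rmult_le_compat; lra. }
    lra.
Qed.

(** * Late first returns *)

Definition psi (k : nat) (y : R) : R :=
  match k with
  | O => heaviside (/ 2) y
  | S _ => ind (/ INR (k + 2)) (/ INR (k + 1)) y / (1 - INR k * y)
  end.

Lemma inv_INR_lt k : / INR (k + 2) < / INR (k + 1).
Proof.
  rewrite !plus_INR; simpl; pose proof (pos_INR k).
  apply Rinv_lt_contravar; nra.
Qed.

Lemma inv_INR_le_iff k y : (0 < k)%nat -> (/ INR k <= y <-> 1 <= INR k * y).
Proof.
  intros Hk; assert (0 < INR k) by now apply lt_0_INR.
  split; intros Hy.
  - apply Rmult_le_compat_l with (r := INR k) in Hy; [|lra].
    rewrite Rinv_r in Hy; lra.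
  - apply Rmult_le_reg_l with (INR k); [easy|]. rewrite Rinv_r; lra.
Qed.

Lemma inYk_weight k y : inYk k y -> (INR k + 2) * (1 - INR k * y) <= 2 /\ 0 < 1 - INR k * y.
Proof.
  intros Hy; destruct k as [|k]; [simpl in *; lra|].
  destruct Hy as [H1 H2].
  apply inv_INR_le_iff in H1; [|lia].
  assert (H3 : INR (S k + 1) * y < 1).
  { apply Rnot_le_lt; intros H; apply inv_INR_le_iff in H; [lra|lia]. }
  rewrite plus_INR in H1, H3; simpl (INR 2) in H1; simpl (INR 1) in H3.
  assert (0 < INR (S k)) by (apply lt_0_INR; lia).
  split; nra.
Qed.

Lemma psi_inYk k y : inYk k y -> psi k y = / (1 - INR k * y).
Proof.
  intros Hy; pose proof (inYk_weight k y Hy); destruct k as [|k].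
  - simpl in *; unfold heaviside; destruct (Rle_dec (/ 2) y); [field|lra].
  - unfold psi. destruct (ind_cases (/ INR (S k + 2)) (/ INR (S k + 1)) y) as [[_ ->]|[Hn _]].
    + left; apply inv_INR_lt.
    + field; lra.
    + now elim Hn.
Qed.

Lemma psi_not_inYk k y : 0 < y <= 1 -> ~ inYk k y -> psi k y = 0.
Proof.
  intros Hy Hn; destruct k as [|k].
  - simpl in *; unfold heaviside; destruct (Rle_dec (/ 2) y); [lra|easy].
  - unfold psi. destruct (ind_cases (/ INR (S k + 2)) (/ INR (S k + 1)) y) as [[Hi _]|[_ ->]].
    + left; apply inv_INR_lt.
    + now elim Hn.
    + unfold Rdiv; ring.
Qed.

Lemma psi_ge0 k y : 0 < y <= 1 -> 0 <= psi k y.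
Proof.
  intros Hy; destruct (classic (inYk k y)) as [H|H].
  - rewrite psi_inYk by easy. left; apply Rinv_0_lt_compat, inYk_weight, H.
  - rewrite psi_not_inYk by easy; lra.
Qed.

Lemma inYk_f10 k x : 0 < x <= 1 -> inYk (S k) (x / (1 + x)) -> inYk k x.
Proof.
  intros Hx [H1 H2].
  apply inv_INR_le_iff in H1; [|lia].
  assert (H3 : INR (S k + 1) * (x / (1 + x)) < 1).
  { apply Rnot_le_lt; intros H; apply inv_INR_le_iff in H; [lra|lia]. }
  rewrite plus_INR, S_INR in H1, H3; simpl (INR 2) in H1; simpl (INR 1) in H3.
  assert (K1 : 1 <= (INR k + 2) * x).
  { apply Rmult_le_compat_r with (r := 1 + x) in H1; [|lra].
    replace ((INR k + 1 + (1 + 1)) * (x / (1 + x)) * (1 + x)) with ((INR k + 3) * x)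
      in H1 by (field; lra). lra. }
  assert (K2 : (INR k + 1) * x < 1).
  { apply Rmult_lt_compat_r with (r := 1 + x) in H3; [|lra].
    replace ((INR k + 1 + 1) * (x / (1 + x)) * (1 + x)) with ((INR k + 2) * x)
      in H3 by (field; lra). lra. }
  destruct k as [|k]; [simpl in *; lra|].
  split.
  - apply inv_INR_le_iff; [lia|]. rewrite plus_INR; simpl (INR 2); lra.
  - apply Rnot_le_lt; intros H; apply inv_INR_le_iff in H; [|lia].
    rewrite plus_INR in H; simpl (INR 1) in H; lra.
Qed.

Lemma not_inYk_upper k y : / INR (k + 2) <= y -> ~ inYk (S k) y.
Proof.
  intros Hy [_ H]. replace (S k + 1)%nat with (k + 2)%nat in H by lia. lra.
Qed.

Lemma Lop_psi k x : 0 < x <= 1 -> Lop (psi (S k)) x <= psi k x.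
Proof.
  intros Hx; unfold Lop.
  pose proof (f11_bounds x ltac:(lra)) as B.
  rewrite (psi_not_inYk (S k) (1 / (1 + x))); [|lra|].
  2: { apply not_inYk_upper, Rle_trans with (2 := proj1 B).
       apply Rinv_le_contravar; [lra|]. rewrite plus_INR; simpl; pose proof (pos_INR k); lra. }
  pose proof (f10_bounds_pos x Hx) as B'.
  destruct (classic (inYk (S k) (x / (1 + x)))) as [H|H].
  - rewrite (psi_inYk (S k) _ H), (psi_inYk k x (inYk_f10 k x Hx H)).
    pose proof (inYk_weight _ _ (inYk_f10 k x Hx H)).
    apply Req_le; rewrite S_INR; field; repeat split; try lra.
  - rewrite psi_not_inYk by easy.
    replace ((0 + x * 0) / (1 + x)) with 0 by (field; lra). now apply psi_ge0.
Qed.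

Lemma Lit_psi j k x : 0 < x <= 1 -> Lit j (psi (k + j)) x <= psi k x.
Proof.
  revert k x; induction j as [|j IH]; intros k x Hx.
  - rewrite Nat.add_0_r; simpl; lra.
  - replace (k + S j)%nat with (S k + j)%nat by lia.
    apply Rle_trans with (2 := Lop_psi k x Hx).
    change (Lit 1 (Lit j (psi (S k + j))) x <= Lit 1 (psi (S k)) x).
    apply Lit_le01; [easy|]. intros y Hy; now apply IH.
Qed.

Lemma Lit_psi_le n k x : (k <= n)%nat -> 0 < x <= 1 ->
  Lit n (psi k) x <= Lit (n - k) (heaviside (/ 2)) x.
Proof.
  intros Hk Hx. replace n with (n - k + k)%nat at 1 by lia.
  rewrite Lit_add_iter. apply Lit_le01; [easy|].
  intros y Hy; exact (Lit_psi k 0 y Hy).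
Qed.

Lemma inYk_cover n y : / INR (n + 2) <= y <= 1 -> exists k, (k <= n)%nat /\ inYk k y.
Proof.
  induction n as [|n IH]; intros Hy.
  - exists 0%nat; split; [lia|]. simpl in *; lra.
  - destruct (Rle_dec (/ INR (n + 2)) y) as [H|H].
    + destruct IH as [k [Hk Hin]]; [lra|]. exists k; split; [lia|easy].
    + exists (S n); split; [lia|]. split; [easy|].
      replace (S n + 1)%nat with (n + 2)%nat by lia. lra.
Qed.

Lemma Rsum_le u v n : (forall i, (i < n)%nat -> u i <= v i) -> Rsum u n <= Rsum v n.
Proof.
  induction n as [|n IH]; intros H; simpl; [lra|].
  apply Rplus_le_compat; [apply IH; intros; apply H; lia|apply H; lia].
Qed.

Lemma Rsum_scal a u n : Rsum (fun i => a * u i) n = a * Rsum u n.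
Proof. induction n as [|n IH]; simpl; [ring|rewrite IH; ring]. Qed.

Lemma Rsum_const a n : Rsum (fun _ => a) n = INR n * a.
Proof. induction n as [|n IH]; [simpl; ring|]. rewrite S_INR; simpl; rewrite IH; ring. Qed.

Lemma Rsum_ge0 u n : (forall i, 0 <= u i) -> 0 <= Rsum u n.
Proof.
  intros H; induction n as [|n IH]; simpl; [lra|]. pose proof (H n); lra.
Qed.

Lemma Rsum_ge_term u n i : (forall i, 0 <= u i) -> (i < n)%nat -> u i <= Rsum u n.
Proof.
  intros H Hi; induction n as [|n IH]; [lia|]; simpl.
  destruct (Nat.eq_dec i n) as [->|].
  - pose proof (Rsum_ge0 u n H); lra.
  - pose proof (IH ltac:(lia)); pose proof (H n); lra.
Qed.

Lemma Rsum_sum_f_R0 c n : Rsum c (S n) = sum_f_R0 c n.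
Proof. induction n as [|n IH]; simpl in *; [ring|]. now rewrite IH. Qed.

Definition tail_of (c : nat -> R) (N k : nat) : R := if le_lt_dec k N then 0 else c k.

Lemma tail_small c : (forall k, 0 <= c k) -> (exists T, forall N, sum_f_R0 c N <= T) ->
  forall eps, 0 < eps -> exists N0, forall N n, (N0 <= N)%nat -> Rsum (tail_of c N) n <= eps.
Proof.
  intros Hc [T HT] eps He.
  set (E := fun r => exists N, r = sum_f_R0 c N).
  destruct (completeness E) as [l [Hl1 Hl2]].
  { exists T; intros r [N ->]; apply HT. }
  { now exists (sum_f_R0 c 0), 0%nat. }
  assert (HN : exists N, l - eps < sum_f_R0 c N).
  { destruct (classic (exists N, l - eps < sum_f_R0 c N)) as [|Hn]; [easy|].
    assert (l <= l - eps); [|lra].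
    apply Hl2; intros r [N ->]. apply Rnot_lt_le; intros H; apply Hn; now exists N. }
  destruct HN as [N0 HN0]. exists N0; intros N n HN.
  assert (E1 : forall n, Rsum (tail_of c N) n = Rsum c (Nat.max n (S N)) - Rsum c (S N)).
  { clear n; intros n; induction n as [|n IH].
    - replace (Nat.max 0 (S N)) with (S N) by lia. simpl; ring.
    - simpl Rsum at 1; rewrite IH; unfold tail_of; destruct (le_lt_dec n N).
      + replace (Nat.max n (S N)) with (S N) by lia.
        replace (Nat.max (S n) (S N)) with (S N) by lia. ring.
      + replace (Nat.max n (S N)) with n by lia.
        replace (Nat.max (S n) (S N)) with (S n) by lia. simpl; ring. }
  rewrite E1.
  assert (H1 : Rsum c (Nat.max n (S N)) <= l).
  { replace (Nat.max n (S N)) with (S (Nat.max n (S N) - 1)) by lia.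
    rewrite Rsum_sum_f_R0; apply Hl1. now eexists. }
  assert (H2 : sum_f_R0 c N0 <= Rsum c (S N)).
  { rewrite <- Rsum_sum_f_R0. replace (S N) with (S N0 + (N - N0))%nat by lia.
    rewrite Rsum_app.
    assert (0 <= Rsum (fun i => c (S N0 + i)%nat) (N - N0)); [|lra].
    apply Rsum_ge0; intros; apply Hc. }
  lra.
Qed.

(* For [k <= n - sqrt n] the factor [ln n / ln (n - k)] is at most [2]; the at most
   [sqrt n] other terms are [O(1/n)] each. *)
Lemma convolution_bound (e b : nat -> R) (M T eps : R) :
  0 <= M -> 0 < eps ->
  (forall k, 0 <= e k) -> (forall k, e k <= 2 * M / (INR k + 2)) ->
  (forall n, Rsum e n <= T) ->
  (forall j, 0 <= b j <= 1) -> (forall j, ln (1 + INR j) * b j <= 2) ->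
  eventually (fun n => ln (INR n) * Rsum (fun k => e k * b (n - k)%nat) (S n) <= 4 * T + eps).
Proof.
  intros HM Heps He HeM HT Hb Hbl.
  set (A := 16 * M / eps + 2).
  assert (HA : 2 <= A).
  { unfold A; assert (0 <= 16 * M / eps) by (apply Rle_div_r; lra); lra. }
  destruct (nfloor_ex (A ^ 4)) as [N HN]; [apply pow_le; lra|].
  exists (S N); intros n Hn.
  apply le_INR in Hn; rewrite S_INR in Hn.
  assert (Hn4 : A ^ 4 < INR n) by lra.
  assert (Hn16 : 16 < INR n).
  { pose proof (pow_incr 2 A 4 ltac:(lra)); lra. }
  set (r := Nat.sqrt n).
  assert (Hr : (r * r <= n < S r * S r)%nat) by (apply (Nat.sqrt_spec n); lia).
  assert (Hr1 : INR r * INR r <= INR n) by (rewrite <- mult_INR; apply le_INR; lia).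
  assert (Hr2 : INR n <= (1 + INR r) * (1 + INR r)).
  { replace (1 + INR r) with (INR (S r)) by (rewrite S_INR; ring).
    rewrite <- mult_INR; apply le_INR; lia. }
  pose proof (pos_INR r) as Hr0.
  assert (Hr3 : INR r <= INR n / 2) by nra.
  assert (Hrn : (r <= n)%nat) by (unfold r; apply Nat.sqrt_le_lin).
  set (l := ln (INR n)).
  assert (Hl : 0 < l) by (unfold l; rewrite <- ln_1; apply ln_increasing; lra).
  set (s := sqrt (sqrt (INR n))).
  assert (Hs2 : s * s = sqrt (INR n)) by (apply sqrt_sqrt, sqrt_pos).
  assert (Hs4 : (s * s) * (s * s) = INR n) by (rewrite Hs2; apply sqrt_sqrt; lra).
  assert (Hs0 : 0 <= s) by apply sqrt_pos.
  assert (HsA : A < s).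
  { apply Rnot_le_lt; intros H.
    assert (s * s <= A * A) by nra.
    assert ((s * s) * (s * s) <= (A * A) * (A * A)) by (apply Rmult_le_compat; nra).
    nra. }
  assert (Hls : l <= 4 * s).
  { unfold l; rewrite <- Hs4, !ln_mult by nra.
    assert (ln s <= s); [|lra].
    rewrite <- (ln_exp s) at 2; apply ln_le; [lra|].
    pose proof (exp_ineq1 s ltac:(lra)); lra. }
  assert (Hrs : INR r <= s * s) by nra.
  replace (S n) with ((S n - r) + r)%nat by lia.
  rewrite Rsum_app, Rmult_plus_distr_l.
  apply Rplus_le_compat.
  - rewrite <- Rsum_scal.
    apply Rle_trans with (Rsum (fun k => 4 * e k) (S n - r)).
    + apply Rsum_le; intros k Hk.
      assert (Hlk : l <= 2 * ln (1 + INR (n - k))).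
      { assert (Hrk : INR r <= INR (n - k)) by (apply le_INR; lia).
        replace (2 * ln (1 + INR (n - k))) with (ln (1 + INR (n - k)) + ln (1 + INR (n - k))) by ring.
        rewrite <- ln_mult by lra. apply ln_le; [lra|nra]. }
      pose proof (Hb (n - k)%nat); pose proof (Hbl (n - k)%nat); pose proof (He k).
      assert (l * b (n - k)%nat <= 4) by nra.
      nra.
    + rewrite Rsum_scal; pose proof (HT (S n - r)%nat); lra.
  - apply Rle_trans with (l * Rsum (fun _ => 4 * M / INR n) r).
    + apply Rmult_le_compat_l; [lra|]. apply Rsum_le; intros i Hi.
      set (k := (S n - r + i)%nat).
      assert (Hk : INR n / 2 <= INR k).
      { apply Rle_trans with (INR (n - r)); [rewrite minus_INR by easy; lra|].
        apply le_INR; unfold k; lia. }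
      assert (He2 : e k <= 4 * M / INR n).
      { apply Rle_trans with (1 := HeM k).
        apply Rle_div_l; [lra|].
        replace (4 * M / INR n * (INR k + 2)) with (4 * M * (INR k + 2) / INR n) by (field; lra).
        apply (Rle_div_r (2 * M) _ (INR n)); [lra|]. nra. }
      pose proof (Hb (n - k)%nat); pose proof (He k). nra.
    + rewrite Rsum_const.
      replace (l * (INR r * (4 * M / INR n))) with (l * INR r * (4 * M) / INR n) by (field; lra).
      apply Rle_div_l; [lra|].
      assert (K1 : l * INR r <= 4 * s * (s * s)) by (apply Rmult_le_compat; lra).
      assert (K2 : 16 * M <= eps * s).
      { unfold A in HsA.
        assert (16 * M / eps <= s) by lra. apply Rle_div_l in H; lra. }
      rewrite <- Hs4.
      apply Rle_trans with (4 * s * (s * s) * (4 * M)); [nra|].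
      replace (4 * s * (s * s) * (4 * M)) with (s * s * s * (16 * M)) by ring.
      replace (eps * (s * s * (s * s))) with (s * s * s * (eps * s)) by ring.
      apply Rmult_le_compat_l; [nra|lra].
Qed.

Lemma farey_tail_bound f M c x : 0 <= M -> / 2 <= x <= 1 ->
  (forall y, 0 <= y <= 1 -> Rabs (f y) <= M) ->
  (forall k y, inYk k y -> Rabs (f y) * (1 - INR k * y) <= c k) ->
  (forall k, 0 <= c k) ->
  forall N T eps, (forall n, Rsum (tail_of c N) n <= T) -> 0 < eps ->
  eventually (fun n => ln (INR n) *
    Rabs (Lit n (fun y => f y * (1 - heaviside (/ INR (N + 2)) y)) x) <= 4 * T + eps).
Proof.
  intros HM Hx HfM Hfc Hc N T eps HT Heps.
  set (e := fun k => Rmin (tail_of c N k) (2 * M / (INR k + 2))).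
  assert (Ht : forall k, 0 <= tail_of c N k).
  { intros k; unfold tail_of; destruct (le_lt_dec k N); [lra|apply Hc]. }
  assert (He : forall k, 0 <= e k).
  { intros k; apply Rmin_glb; [apply Ht|].
    pose proof (pos_INR k); apply Rle_div_r; lra. }
  assert (Hev := convolution_bound e (fun j => Lit j (heaviside (/ 2)) x) M T eps HM Heps He
    (fun k => Rmin_r _ _)
    (fun n => Rle_trans _ _ _ (Rsum_le _ _ n (fun i _ => Rmin_l _ _)) (HT n))
    (fun j => proj1 (heaviside_half_bound j x Hx))
    (fun j => proj2 (heaviside_half_bound j x Hx))).
  apply (filter_imp _ _) with (2 := filter_and _ _ INR_eventually_ge1 Hev).
  intros n [Hn1 Hn]. apply Rle_trans with (2 := Hn).
  apply Rmult_le_compat_l; [now apply ln_INR_nonneg|].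
  apply Rle_trans with (Lit n (fun y => Rsum (fun k => e k * psi k y) (S n)) x).
  - apply Lit_abs_le; [lra|]. intros y Hy.
    assert (Hy2 : / INR (n + 2) <= y <= 1).
    { split; [|lra]. apply Rle_trans with (2 := proj1 Hy).
      rewrite plus_INR; simpl (INR 2). pose proof (pos_INR n).
      apply Rle_div_r; [nra|]. rewrite Rmult_comm; apply Rle_div_l; nra. }
    assert (Hy0 : 0 < y).
    { apply Rlt_le_trans with (2 := proj1 Hy2), Rinv_0_lt_compat, lt_0_INR; lia. }
    destruct (inYk_cover n y Hy2) as [k [Hk Hin]].
    assert (Hpos : forall i, 0 <= e i * psi i y).
    { intros i; apply Rmult_le_pos; [apply He|apply psi_ge0; lra]. }
    unfold heaviside; destruct (Rle_dec (/ INR (N + 2)) y) as [H|H].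
    { rewrite Rminus_diag, Rmult_0_r, Rabs_R0; now apply Rsum_ge0. }
    rewrite Rminus_0_r, Rmult_1_r.
    apply Rle_trans with (2 := Rsum_ge_term _ (S n) k Hpos ltac:(lia)).
    destruct (inYk_weight k y Hin) as [W1 W2].
    rewrite (psi_inYk k y Hin).
    apply Rle_div_r; [easy|].
    apply Rmin_glb.
    + unfold tail_of; destruct (le_lt_dec k N) as [HkN|HkN]; [|now apply Hfc].
      exfalso; apply H. destruct k as [|k]; [simpl in Hin|destruct Hin as [Hin _]].
      * apply Rle_trans with (2 := proj1 Hin). apply Rinv_le_contravar; [lra|].
        rewrite plus_INR; simpl; pose proof (pos_INR N); lra.
      * apply Rle_trans with (2 := Hin). apply Rinv_le_contravar; [apply lt_0_INR; lia|].
        apply le_INR; lia.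
    + pose proof (pos_INR k). apply (Rle_div_r _ _ (INR k + 2)); [lra|].
      pose proof (HfM y ltac:(lra)); pose proof (Rabs_pos (f y)). nra.
  - rewrite (Lit_Rsum n (fun k y => e k * psi k y)). apply Rsum_le; intros k Hk.
    rewrite (Lit_scal n (e k) (psi k)).
    apply Rmult_le_compat_l; [apply He|]. apply Lit_psi_le; [lia|lra].
Qed.

Theorem farey_limit_real f M I c x :
  (forall y, 0 <= y <= 1 -> Rabs (f y) <= M) ->
  HK_integral (fun y => f y * / y) 0 1 I ->
  (forall N, exists W, variation_dominated f W (/ INR (N + 2)) 1) ->
  (forall k y, inYk k y -> Rabs (f y) * (1 - INR k * y) <= c k) ->
  (forall k, 0 <= c k) -> (exists T, forall N, sum_f_R0 c N <= T) ->
  / 2 <= x <= 1 ->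
  is_lim_seq (fun n => ln (INR n) * Lit n f x) I.
Proof.
  intros HM HI HW Hc Hc0 HT Hx.
  apply is_lim_seq_spec; intros [eps Heps]; unfold pos.
  assert (HM0 : 0 <= M).
  { eapply Rle_trans; [apply Rabs_pos|apply (HM 0); lra]. }
  destruct (HK_integral_riemann_sum _ _ _ _ (eps / 8) HI ltac:(lra)) as [delta [Hd HS]].
  destruct (tail_small c Hc0 HT (eps / 32) ltac:(lra)) as [N0 HN0].
  destruct (nfloor_ex (/ delta 0)) as [N1 HN1].
  { left; apply Rinv_0_lt_compat, Hd. }
  set (N := (N0 + N1)%nat).
  set (eta := / INR (N + 2)).
  assert (HN2 : 2 <= INR (N + 2)) by (rewrite plus_INR; simpl; pose proof (pos_INR N); lra).
  assert (Heta : 0 < eta < 1).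
  { split; [apply Rinv_0_lt_compat; lra|].
    rewrite <- Rinv_1; apply Rinv_lt_contravar; lra. }
  assert (Hed : eta < delta 0).
  { rewrite <- (Rinv_inv (delta 0)). apply Rinv_lt_contravar.
    - apply Rmult_lt_0_compat; [apply Rinv_0_lt_compat, Hd|lra].
    - unfold N; rewrite !plus_INR; simpl; pose proof (pos_INR N0); lra. }
  destruct (HW N) as [W HWN]; fold eta in HWN.
  assert (HWeta : 0 <= W 1 - W eta).
  { eapply Rle_trans; [apply Rabs_pos|apply (HWN eta 1); lra]. }
  set (D := (1 - eta) + (W 1 - W eta)).
  assert (HD : 0 < D) by (unfold D; lra).
  destruct (riemann_sum_approx f W delta eta M (eps / (8 * D)) x Heta
              (fun y Hy => HM y ltac:(lra)) HWN Hd) as [S [HS1 HS2]]; [|easy|].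
  { apply Rdiv_lt_0_compat; lra. }
  fold D in HS2.
  replace (eps / (8 * D) * D) with (eps / 8) in HS2 by (field; lra).
  (* The cell [0, eta] is tagged at 0, where [f 0 * / 0 = 0]. *)
  assert (HSI : Rabs (S - I) < eps / 8).
  { apply HS. replace S with (f 0 * / 0 * (eta - 0) + S) by (rewrite Rinv_0; ring).
    apply riemann_sum_trans with eta; [|easy].
    apply (riemann_sum_single delta (fun y => f y * / y) 0 eta 0); lra || (pose proof (Hd 0); lra). }
  pose proof (farey_tail_bound f M c x HM0 Hx HM Hc Hc0 N (eps / 32) (eps / 8)
    (fun n => HN0 N n ltac:(unfold N; lia)) ltac:(lra)) as Tail.
  fold eta in Tail.
  assert (Hend : is_lim_seq (fun n => f 1 * (ln (INR n) * Lit n (heaviside 1) x)) (f 1 * - ln 1)).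
  { apply (is_lim_seq_scal_l _ (f 1) (Finite (- ln 1))). apply heaviside_limit; lra. }
  rewrite ln_1, Ropp_0, Rmult_0_r in Hend.
  apply is_lim_seq_spec in Hend.
  assert (He8 : 0 < eps / 8) by lra.
  apply (filter_imp _ _) with (2 := filter_and _ _ INR_eventually_ge1
    (filter_and _ _ (Hend (mkposreal _ He8)) (filter_and _ _ HS2 Tail))).
  intros n [Hn1 [H1 [H2 H3]]]. simpl in H1; rewrite Rminus_0_r in H1.
  rewrite (Lit_ext n f (fun y => f y * (1 - heaviside eta y) +
            (f y * ind eta 1 y + f 1 * heaviside 1 y))); [|lra|].
  2: { intros y Hy; unfold ind, heaviside.
       destruct (Rle_dec eta y), (Rle_dec 1 y); try ring; try lra.
       replace y with 1 by lra; ring. }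
  rewrite !Lit_plus, (Lit_scal n (f 1) (heaviside 1)).
  rewrite <- (Rabs_pos_eq (ln (INR n))) in H3 by now apply ln_INR_nonneg.
  rewrite <- Rabs_mult in H3.
  match goal with |- Rabs ?z < _ => match type of H3 with Rabs ?z3 <= _ =>
    match type of H2 with Rabs ?z2 <= _ => match type of H1 with Rabs ?z1 < _ =>
      replace z with (z3 + (z2 + (z1 + (S - I)))) by ring end end end end.
  eapply Rle_lt_trans; [apply Rabs_triang|].
  eapply Rle_lt_trans; [apply Rplus_le_compat_l, Rabs_triang|].
  eapply Rle_lt_trans; [apply Rplus_le_compat_l, Rplus_le_compat_l, Rabs_triang|].
  lra.
Qed.

(** * Bounded variation of the induced functions *)

Definition component (pr : Cpx -> R) : Prop := pr = fst \/ pr = snd.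

Lemma component_le_Cnorm pr z : component pr -> Rabs (pr z) <= Cnorm z.
Proof.
  intros [-> | ->]; unfold Cnorm; rewrite <- sqrt_Rsqr_abs; apply sqrt_le_1_alt; unfold Rsqr;
    pose proof (pow2_ge_0 (fst z)); pose proof (pow2_ge_0 (snd z)); simpl in *; lra.
Qed.

Lemma Cnorm_le_components z : Cnorm z <= Rabs (fst z) + Rabs (snd z).
Proof.
  pose proof (Rabs_pos (fst z)); pose proof (Rabs_pos (snd z)).
  unfold Cnorm.
  rewrite <- (sqrt_Rsqr (Rabs (fst z) + Rabs (snd z))) by lra.
  apply sqrt_le_1_alt. rewrite <- (pow2_abs (fst z)), <- (pow2_abs (snd z)).
  unfold Rsqr; nra.
Qed.

Lemma component_Csub pr z w : component pr -> pr (Csub z w) = pr z - pr w.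
Proof. now intros [-> | ->]. Qed.

Lemma component_Cscal pr a z : component pr -> pr (Cscal a z) = a * pr z.
Proof. now intros [-> | ->]. Qed.

Lemma component_Cadd pr z w : component pr -> pr (Cadd z w) = pr z + pr w.
Proof. now intros [-> | ->]. Qed.

Lemma component_C0 pr : component pr -> pr C0 = 0.
Proof. now intros [-> | ->]. Qed.

Lemma component_hatT1 pr g x : component pr -> 0 < x ->
  pr (hatT1 g x) = Lop (fun y => pr (g y)) x.
Proof.
  intros Hpr Hx; unfold hatT1, P1, Lop, h1, df10, df11.
  rewrite component_Cscal, component_Cadd, !component_Cscal by easy.
  assert (0 < / (1 + x) ^ 2) by (apply Rinv_0_lt_compat; nra).
  rewrite Rabs_Ropp, Rabs_pos_eq by lra.
  unfold f10, f11; field; lra.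
Qed.

Lemma component_hatT1_iter pr n g x : component pr -> 0 < x ->
  pr (hatT1_iter n g x) = Lit n (fun y => pr (g y)) x.
Proof.
  intros Hpr; revert x; induction n as [|n IH]; intros x Hx; [easy|].
  rewrite Lit_S; change (hatT1_iter (S n) g x) with (hatT1 (hatT1_iter n g) x).
  rewrite component_hatT1 by easy. unfold Lop.
  rewrite !IH; [easy| |]; apply Rdiv_lt_0_compat; lra.
Qed.

Lemma Lit_left_branch j u x :
  ((0 < j)%nat -> forall y, / INR (j + 1) <= y <= 1 -> u y = 0) -> 0 < x <= 1 ->
  Lit j u x = u (x / (1 + INR j * x)) / (1 + INR j * x).
Proof.
  revert x; induction j as [|j IH]; intros x Hu Hx.
  - simpl. replace (x / (1 + 0 * x)) with x by field. field.
  - pose proof (pos_INR j) as Hj.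
    assert (Hu' : forall y, / INR (j + 1) <= y <= 1 -> u y = 0).
    { intros y Hy; apply Hu; [lia|]. split; [|lra].
      apply Rle_trans with (2 := proj1 Hy), Rinv_le_contravar;
        [apply lt_0_INR; lia|apply le_INR; lia]. }
    pose proof (f11_bounds x ltac:(lra)).
    rewrite Lit_S; unfold Lop.
    rewrite (IH (x / (1 + x))) by (easy || now apply f10_bounds_pos).
    rewrite (IH (1 / (1 + x))) by (easy || lra).
    rewrite f10_iter by lra.
    rewrite (Hu (Nat.lt_0_succ j) (1 / (1 + x) / (1 + INR j * (1 / (1 + x))))).
    + rewrite S_INR; field; repeat split; nra.
    + replace (1 / (1 + x) / (1 + INR j * (1 / (1 + x)))) with (/ (1 + x + INR j))
        by (field; lra).
      rewrite plus_INR, S_INR; simpl (INR 1); split.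
      * apply Rinv_le_contravar; lra.
      * rewrite <- Rinv_1; apply Rinv_le_contravar; lra.
Qed.

Lemma restrYk_inYk k g y : inYk k y -> restrYk k g y = g y.
Proof.
  destruct k as [|k]; intros [H1 H2]; unfold restrYk.
  - destruct (Rle_dec (/ 2) y), (Rle_dec y 1); easy || lra.
  - destruct (Rle_dec (/ INR (S k + 2)) y), (Rlt_dec y (/ INR (S k + 1))); easy || lra.
Qed.

Lemma restrYk_above k g y : (0 < k)%nat -> / INR (k + 1) <= y -> restrYk k g y = C0.
Proof.
  destruct k as [|k]; [lia|]; intros _ Hy; unfold restrYk.
  destruct (Rle_dec (/ INR (S k + 2)) y), (Rlt_dec y (/ INR (S k + 1))); easy || lra.
Qed.

Definition unfold_left (k : nat) (y : R) : R := y / (1 - INR k * y).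

Lemma left_denominator k y : 0 <= y <= / INR (k + 1) -> / (INR k + 1) <= 1 - INR k * y.
Proof.
  rewrite plus_INR; simpl (INR 1); intros Hy; pose proof (pos_INR k).
  assert (INR k * y <= INR k * / (INR k + 1)) by (apply Rmult_le_compat_l; lra).
  replace (/ (INR k + 1)) with (1 - INR k * / (INR k + 1)) by (field; lra). lra.
Qed.

Lemma unfold_left_incr k y z : 0 <= y -> y <= z -> z <= / INR (k + 1) ->
  0 <= unfold_left k y <= unfold_left k z /\ unfold_left k z <= 1.
Proof.
  intros Hy Hyz Hz.
  pose proof (left_denominator k y ltac:(lra)) as Dy.
  pose proof (left_denominator k z ltac:(lra)) as Dz.
  pose proof (pos_INR k).
  assert (0 < / (INR k + 1)) by (apply Rinv_0_lt_compat; lra).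
  unfold unfold_left; repeat split.
  - apply Rle_div_r; lra.
  - apply Rle_div_l; [lra|].
    replace (z / (1 - INR k * z) * (1 - INR k * y))
      with (z * (1 - INR k * y) / (1 - INR k * z)) by (field; lra).
    apply Rle_div_r; [lra|]. nra.
  - apply Rle_div_l; [lra|].
    apply Rmult_le_compat_l with (r := INR k + 1) in Hz; [|lra].
    rewrite plus_INR in Hz; simpl (INR 1) in Hz; rewrite Rinv_r in Hz; lra.
Qed.

Lemma inYk_bounds k y : inYk k y -> 0 < y <= / INR (k + 1).
Proof.
  destruct k as [|k]; intros [H1 H2].
  - simpl; lra.
  - split; [|lra]. apply Rlt_le_trans with (2 := H1), Rinv_0_lt_compat, lt_0_INR; lia.
Qed.

Lemma component_induced pr k f y : component pr -> inYk k y ->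
  pr (hatT1_iter k (restrYk k f) (unfold_left k y)) = pr (f y) * (1 - INR k * y).
Proof.
  intros Hpr Hy. pose proof (inYk_bounds k y Hy) as By.
  pose proof (unfold_left_incr k y y ltac:(lra) ltac:(lra) ltac:(lra)) as Bx.
  destruct (inYk_weight k y Hy) as [_ Hw].
  assert (0 < unfold_left k y) by (apply Rdiv_lt_0_compat; lra).
  rewrite component_hatT1_iter by easy.
  rewrite Lit_left_branch; [|intros Hk z Hz; rewrite restrYk_above by easy;
    now apply component_C0|lra].
  replace (unfold_left k y / (1 + INR k * unfold_left k y)) with y
    by (unfold unfold_left; field; lra).
  rewrite restrYk_inYk by easy. unfold unfold_left; field; lra.
Qed.

Definition variation_sums (g : R -> R) (x r : R) : Prop :=
  exists (n : nat) (p : nat -> R), p O = 0 /\ p n = x /\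
    (forall i, (i < n)%nat -> p i <= p (S i)) /\
    r = Rsum (fun i => Rabs (g (p (S i)) - g (p i))) n.

Lemma variation_sums_extend g x y r : x <= y -> variation_sums g x r ->
  variation_sums g y (r + Rabs (g y - g x)).
Proof.
  intros Hxy [n [p [H0 [Hn [Hp ->]]]]].
  set (p' := fun i => if le_lt_dec i n then p i else y).
  assert (E : forall i, (i <= n)%nat -> p' i = p i).
  { intros i Hi; unfold p'; destruct (le_lt_dec i n); [easy|lia]. }
  assert (E' : p' (S n) = y).
  { unfold p'; destruct (le_lt_dec (S n) n); [lia|easy]. }
  exists (S n), p'; split; [|split; [|split]].
  - now rewrite E by lia.
  - easy.
  - intros i Hi; destruct (Nat.eq_dec i n) as [->|].
    + rewrite E', E, Hn by lia; easy.
    + rewrite !E by lia; apply Hp; lia.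
  - simpl; f_equal.
    + apply Rsum_ext; intros i Hi; now rewrite !E by lia.
    + now rewrite E', E, Hn by lia.
Qed.

Lemma bounded_variation_dominated g V :
  (forall r, variation_sums g 1 r -> r <= V) -> exists W, variation_dominated g W 0 1.
Proof.
  intros HV.
  exists (fun x => real (Lub_Rbar (variation_sums g x))).
  assert (Hlub : forall x, 0 <= x <= 1 ->
            is_lub (variation_sums g x) (real (Lub_Rbar (variation_sums g x)))).
  { intros x Hx.
    destruct (completeness (variation_sums g x)) as [m Hm].
    - exists V; intros r Hr.
      pose proof (HV _ (variation_sums_extend g x 1 r ltac:(lra) Hr)).
      pose proof (Rabs_pos (g 1 - g x)); lra.
    - exists (0 + Rabs (g x - g 0)). apply variation_sums_extend; [lra|].
      exists 0%nat, (fun _ => 0); repeat split; intros; lia.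
    - rewrite (is_lub_Rbar_unique _ (Finite m)); [easy|].
      destruct Hm as [Hm1 Hm2]; split; [exact Hm1|].
      intros [l| |] Hl; simpl; [now apply Hm2|easy|].
      exact (Hl _ (variation_sums_extend g 0 x 0 ltac:(lra)
        (ex_intro _ 0%nat (ex_intro _ (fun _ => 0)
          (conj eq_refl (conj eq_refl (conj (fun i Hi => False_ind _ (Nat.nlt_0_r i Hi)) eq_refl))))))). }
  intros p q Hp Hpq Hq.
  destruct (Hlub p ltac:(lra)) as [_ Hp2], (Hlub q ltac:(lra)) as [Hq1 _].
  set (Wq := real (Lub_Rbar (variation_sums g q))) in *.
  assert (real (Lub_Rbar (variation_sums g p)) <= Wq - Rabs (g q - g p)); [|lra].
  apply Hp2; intros r Hr.
  pose proof (Hq1 _ (variation_sums_extend g p q r Hpq Hr)); lra.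
Qed.

Lemma BV_component pr g : component pr -> bounded_variation01 g ->
  exists W, variation_dominated (fun x => pr (g x)) W 0 1.
Proof.
  intros Hpr [V HV]; apply bounded_variation_dominated with V.
  intros r [n [p [H0 [Hn [Hp ->]]]]].
  apply Rle_trans with (2 := HV n p H0 Hn Hp).
  apply Rsum_le; intros i Hi. rewrite <- component_Csub by easy.
  now apply component_le_Cnorm.
Qed.

Lemma variation_dominated_close f g W a b : variation_dominated g W a b ->
  (forall y, a <= y < b -> f y = g y) -> exists W', variation_dominated f W' a b.
Proof.
  intros HW Hfg.
  exists (fun y => if Rlt_dec y b then W y else W b + Rabs (f b - g b)).
  intros p q Hp Hpq Hq.
  destruct (Rlt_dec p b) as [Hpb|Hpb], (Rlt_dec q b) as [Hqb|Hqb]; try lra.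
  - rewrite !Hfg by lra; now apply HW.
  - replace q with b by lra. rewrite (Hfg p) by lra.
    replace (f b - g p) with ((g b - g p) + (f b - g b)) by ring.
    eapply Rle_trans; [apply Rabs_triang|].
    pose proof (HW p b ltac:(lra) ltac:(lra) ltac:(lra)); lra.
  - replace q with p by lra. rewrite Rminus_diag, Rabs_R0; lra.
Qed.

Lemma variation_dominated_glue f W1 W2 a b c :
  variation_dominated f W1 a b -> variation_dominated f W2 b c -> a <= b <= c ->
  exists W, variation_dominated f W a c.
Proof.
  intros H1 H2 Habc.
  exists (fun y => if Rle_dec y b then W1 y else W1 b + (W2 y - W2 b)).
  intros p q Hp Hpq Hq.
  destruct (Rle_dec p b) as [Hpb|Hpb], (Rle_dec q b) as [Hqb|Hqb]; try lra.
  - apply H1; lra.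
  - replace (f q - f p) with ((f q - f b) + (f b - f p)) by ring.
    eapply Rle_trans; [apply Rabs_triang|].
    pose proof (H1 p b ltac:(lra) ltac:(lra) ltac:(lra)).
    pose proof (H2 b q ltac:(lra) ltac:(lra) ltac:(lra)); lra.
  - pose proof (H2 p q ltac:(lra) ltac:(lra) ltac:(lra)); lra.
Qed.

Lemma variation_dominated_Yk pr k f C : component pr ->
  bounded_variation01 (hatT1_iter k (restrYk k f)) ->
  (forall x, 0 <= x <= 1 -> Cnorm (hatT1_iter k (restrYk k f) x) <= C) ->
  exists W, variation_dominated (fun y => pr (f y)) W (/ INR (k + 2)) (/ INR (k + 1)).
Proof.
  intros Hpr HBV HC.
  set (g := fun x => pr (hatT1_iter k (restrYk k f) x)).
  destruct (BV_component pr _ Hpr HBV) as [V HV]; fold g in HV.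
  assert (Hg : forall x, 0 <= x <= 1 -> Rabs (g x) <= C).
  { intros x Hx; apply Rle_trans with (2 := HC x Hx). now apply component_le_Cnorm. }
  set (X := unfold_left k).
  pose proof (pos_INR k) as Hk.
  assert (Ha : 0 < / INR (k + 2)) by (apply Rinv_0_lt_compat, lt_0_INR; lia).
  apply variation_dominated_close with
    (g := fun y => g (X y) * (1 + INR k * X y))
    (W := fun y => (1 + INR k) * V (X y) + C * (INR k * X y)).
  - intros p q Hp Hpq Hq.
    destruct (unfold_left_incr k p q ltac:(lra) Hpq Hq) as [H1 H2]; fold X in H1, H2.
    pose proof (HV (X p) (X q) ltac:(lra) ltac:(lra) H2) as Hv.
    pose proof (Hg (X p) ltac:(lra)) as Hgp.
    replace (g (X q) * (1 + INR k * X q) - g (X p) * (1 + INR k * X p))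
      with ((1 + INR k * X q) * (g (X q) - g (X p)) + g (X p) * (INR k * (X q - X p))) by ring.
    eapply Rle_trans; [apply Rabs_triang|]. rewrite !Rabs_mult.
    rewrite (Rabs_pos_eq (1 + INR k * X q)) by nra.
    rewrite (Rabs_pos_eq (INR k)), (Rabs_pos_eq (X q - X p)) by lra.
    assert (K1 : (1 + INR k * X q) * Rabs (g (X q) - g (X p)) <= (1 + INR k) * (V (X q) - V (X p))).
    { apply Rmult_le_compat; [nra|apply Rabs_pos|nra|easy]. }
    assert (K2 : Rabs (g (X p)) * (INR k * (X q - X p)) <= C * (INR k * (X q - X p))).
    { apply Rmult_le_compat_r; [apply Rmult_le_pos; lra|easy]. }
    lra.
  - intros y Hy.
    assert (Hin : inYk k y).
    { destruct k as [|k]; [simpl in *; lra|exact Hy]. }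
    unfold g, X; rewrite (component_induced pr k f y Hpr Hin).
    destruct (inYk_weight k y Hin) as [_ Hw]. unfold unfold_left; field; lra.
Qed.

Theorem theorem4p13 (f : R -> Cpx)
  (Hbdd : bounded01 f)
  (Hint : mu1_integrable f)
  (HBV : forall k : nat, BV_Y (hatT1_iter k (restrYk k f)))
  (Hsum : exists c : nat -> R,
      (forall k, sup_norm_is (hatT1_iter k (restrYk k f)) (c k)) /\
      exists M, forall N, sum_f_R0 c N <= M) :
  forall x, inY x -> forall I : Cpx, mu1_integral_is f I ->
    forall eps, 0 < eps -> exists N : nat, forall n : nat, (n >= N)%nat ->
      Cnorm (Csub (Cscal (ln (INR n)) (hatT1_iter n f x)) I) < eps.
Proof.
  intros x Hx I [HI1 HI2] eps Heps.
  destruct Hbdd as [M HM], Hsum as [c [Hc HT]].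
  assert (Hcn : forall k y, 0 <= y <= 1 -> Cnorm (hatT1_iter k (restrYk k f) y) <= c k).
  { intros k y Hy; apply (proj1 (Hc k)); now exists y. }
  assert (Hc0 : forall k, 0 <= c k).
  { intros k; apply Rle_trans with (2 := Hcn k 0 ltac:(lra)), sqrt_pos. }
  assert (Hlim : forall pr J, component pr ->
            HK_integral (fun y => pr (f y) * / y) 0 1 J ->
            is_lim_seq (fun n => ln (INR n) * pr (hatT1_iter n f x)) J).
  { intros pr J Hpr HJ.
    apply is_lim_seq_ext with (fun n => ln (INR n) * Lit n (fun y => pr (f y)) x).
    { intros n; rewrite component_hatT1_iter; [easy|easy|destruct Hx; lra]. }
    apply farey_limit_real with M c; try easy.
    - intros y Hy; apply Rle_trans with (2 := HM y Hy). now apply component_le_Cnorm.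
    - assert (Hpiece : forall k, exists W, variation_dominated (fun y => pr (f y)) W
                (/ INR (k + 2)) (/ INR (k + 1))).
      { intros k; apply variation_dominated_Yk with (c k); [easy|apply HBV|apply Hcn]. }
      induction N as [|N [W HW]].
      + destruct (Hpiece 0%nat) as [W HW]; exists W.
        simpl (INR (0 + 1)) in HW; rewrite Rinv_1 in HW; exact HW.
      + destruct (Hpiece (S N)) as [W' HW'].
        replace (S N + 1)%nat with (N + 2)%nat in HW' by lia.
        apply (variation_dominated_glue _ W' W _ _ _ HW' HW).
        split.
        * apply Rinv_le_contravar; [apply lt_0_INR; lia|apply le_INR; lia].
        * rewrite <- Rinv_1; apply Rinv_le_contravar; [lra|].
          apply (le_INR 1); lia.
    - intros k y Hy.
      destruct (inYk_weight k y Hy) as [_ Hw].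
      rewrite <- (Rabs_pos_eq (1 - INR k * y)) by lra.
      rewrite <- Rabs_mult, <- component_induced by easy.
      eapply Rle_trans; [now apply component_le_Cnorm|]. apply Hcn.
      pose proof (inYk_bounds k y Hy).
      pose proof (unfold_left_incr k y y ltac:(lra) ltac:(lra) ltac:(lra)); lra. }
  assert (Heps2 : 0 < eps / 2) by lra.
  pose proof (Hlim fst (fst I) (or_introl eq_refl) HI1) as L1.
  pose proof (Hlim snd (snd I) (or_intror eq_refl) HI2) as L2.
  apply is_lim_seq_spec in L1; apply is_lim_seq_spec in L2.
  destruct (filter_and _ _ (L1 (mkposreal _ Heps2)) (L2 (mkposreal _ Heps2))) as [N HN].
  exists N; intros n Hn; destruct (HN n Hn) as [H1 H2]; simpl in H1, H2.
  eapply Rle_lt_trans; [apply Cnorm_le_components|]. simpl; lra.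
Qed.
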